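(* Let $\mathcal{G}=(X,Y,A,B,\lambda)$ be a regular mirror game (with respect to functions $\xi:X\to Y$, $\eta:Y\to X$) with universal game algebra $\mathcal{U}$. Then $\mathcal{G}$ has a perfect commuting operator strategy if and only if $$-1\notin\widetilde{\operatorname{SOS}}_{\mathcal{U}(1)}+\mathcal{J}(\mathrm{mir1})+\mathcal{J}(\mathrm{mir1})^*.$$ In particular, if $$-1\in\operatorname{SOS}_{\mathcal{U}(1)}+\mathcal{J}(\mathrm{mir1})+\mathcal{J}(\mathrm{mir1})^*,$$ then $\mathcal{G}$ has no perfect commuting operator strategy. The same two statements hold with $\mathcal{U}(1)$ and $\mathcal{J}(\mathrm{mir1})$ replaced by $\mathcal{U}(2)$ and $\mathcal{J}(\mathrm{mir2})$, respectively.
   Context: Nonlocal game: $X,Y$ (questions) and $A,B$ (answers) are non-empty finite sets and $\lambda:X\times Y\times A\times B\to\{0,1\}$ is a scoring function; questions $(x,y)$ are drawn from the uniform distribution on $X\times Y$. Mirror game: a nonlocal game $\mathcal{G}=(X,Y,A,B,\lambda)$ for which there are functions $\xi:X\to Y$, $\eta:Y\to X$ (fixed as part of the data) with $\lambda(x,\xi(x),a,b)\lambda(x,\xi(x),a',b)=0$ for all $x\in X$, $a\ne a'\in A$, $b\in B$, and $\lambda(\eta(y),y,a,b)\lambda(\eta(y),y,a,b')=0$ for all $y\in Y$, $a\in A$, $b\neq b'\in B$. Regular: with $E_{x,y}^a=\{b\in B:\lambda(x,y,a,b)=1\}$ and $E_{x,y}^b=\{a\in A:\lambda(x,y,a,b)=1\}$,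 the mirror game is regular if $\bigcup_{a\in A}E_{x,\xi(x)}^a=B$ for all $x\in X$ and $\bigcup_{b\in B}E_{\eta(y),y}^b=A$ for all $y\in Y$. Universal game algebra: $\mathcal{U}=\mathbb{C}\langle e(1)^x_a,\,e(2)^y_b : x\in X,a\in A,y\in Y,b\in B\rangle/\mathscr{I}$, where $\mathscr{I}$ is the two-sided ideal of the free algebra generated by $e(1)^x_ae(2)^y_b-e(2)^y_be(1)^x_a$; $(e(1)^x_a)^2-e(1)^x_a$; $(e(2)^y_b)^2-e(2)^y_b$; $e(1)^x_{a_1}e(1)^x_{a_2}$ ($a_1\ne a_2$); $e(2)^y_{b_1}e(2)^y_{b_2}$ ($b_1\neq b_2$); $\sum_{a\in A}e(1)^x_a-1$; $\sum_{b\in B}e(2)^y_b-1$ (for all $x,y,a,b$). The involution $*$ (conjugate-linear, anti-multiplicative) fixes each generator. $\mathcal{U}(1)$ is the subalgebra of $\mathcal{U}$ generated by the $e(1)^x_a$, and $\mathcal{U}(2)$ the subalgebra generated by the $e(2)^y_b$. Commuting operator strategy: a pair $(\pi,|\psi\rangle)$ with $\pi:\mathcal{U}\to\mathcal{B}(\mathcal{H})$ a unital *-homomorphism into the bounded operators on a (possibly infinite-dimensional) Hilbert space $\mathcal{H}$ and $|\psi\rangle\in\mathcal{H}$ a unit vector. It is perfect if it wins with certainty, i.e. $\langle\psi|\pi(\Phi_{\mathcal{G}})|\psi\rangle=1$, where $\Phi_{\mathcal{G}}=\frac{1}{|X||Y|}\sum_{x,y,a,b}\lambda(x,y,a,b)\,e(1)^x_ae(2)^y_b$.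 Define $f^{\eta(y)}_{y,b}=\sum_{a\in A,\ \lambda(\eta(y),y,a,b)=1}e(1)^{\eta(y)}_a\in\mathcal{U}(1)$ and $g^{\xi(x)}_{x,a}=\sum_{b\in B,\ \lambda(x,\xi(x),a,b)=1}e(2)^{\xi(x)}_b\in\mathcal{U}(2)$. Then $\mathcal{J}(\mathrm{mir1})$ is the two-sided ideal of $\mathcal{U}(1)$ generated by $\{e(1)^x_af^{\eta(y)}_{y,b}:\lambda(x,y,a,b)=0\}$, and $\mathcal{J}(\mathrm{mir2})$ is the two-sided ideal of $\mathcal{U}(2)$ generated by $\{e(2)^y_bg^{\xi(x)}_{x,a}:\lambda(x,y,a,b)=0\}$. For a subset $S$, $S^*=\{s^*:s\in S\}$. For a *-algebra $\mathcal{A}$: $\operatorname{SOS}_{\mathcal{A}}=\{\sum_{i=1}^n u_i^*u_i: u_i\in\mathcal{A},\,n\in\mathbb{N}\}$, and $\widetilde{\operatorname{SOS}}_{\mathcal{A}}=\{a\in\mathcal{A}:\exists\, b\in\operatorname{SOS}_{\mathcal{A}}\text{ such that }a-b\text{ is a (finite) sum of commutators }cd-dc,\ c,d\in\mathcal{A}\}$. *)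

(* Defs.v *)
From HB Require Import structures.
From mathcomp Require Import all_boot all_order all_algebra sesquilinear.
From mathcomp Require Import generic_quotient ring_quotient complex finmap.
From mathcomp Require Import boolp classical_sets reals topology normedtype.
(* The notations of monalg do not parse together with those of the analysis
   library: below, [malg K C] is the monoid algebra of K over C, [mkmalgU k c]
   is c times the basis element k, and [mcoeff k f] is the coefficient of f
   at k. *)
From mathcomp Require Import -(notations) monalg.

Set Implicit Arguments.
Unset Strict Implicit.
Unset Printing Implicit Defensive.

Import Order.TTheory GRing.Theory Num.Theory.
Local Open Scope ring_scope.
Local Open Scope quotient_scope.

HB.mixin Record isStarAlgebra (C : numClosedFieldType) A
    of GRing.Algebra C A := {
  star : A -> A;
  starK : involutive star;
  starD : {morph star : u v / u + v};
  starZ : forall (c : C) u, star (c *: u) = c^* *: star u;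
  starM : forall u v, star (u * v) = star v * star u
}.

#[short(type="starAlgType")]
HB.structure Definition StarAlgebra (C : numClosedFieldType) :=
  { A of isStarAlgebra C A & GRing.Algebra C A }.

Section StarTheory.
Variables (C : numClosedFieldType) (A : starAlgType C).

Lemma star0 : star (0 : A) = 0.
Proof. by rewrite -[X in star X](@scale0r C A 0) starZ rmorph0 scale0r. Qed.

Lemma starN (u : A) : star (- u : A) = - star u.
Proof. by rewrite -[in LHS](@scaleN1r C A) starZ rmorphN1 scaleN1r. Qed.

Lemma star1 : star (1 : A) = 1.
Proof. by rewrite -[LHS]mulr1 -[X in _ * X]starK -starM mulr1 starK. Qed.

Lemma star_sum (J : Type) (r : seq J) (P : pred J) (f : J -> A) :
  star (\sum_(j <- r | P j) f j : A) = \sum_(j <- r | P j) star (f j).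
Proof. exact: (big_morph _ (@starD C A) star0). Qed.

End StarTheory.

Section Subsets.
Variables (C : numClosedFieldType) (A : algType C).
Implicit Types (S I G : set A).

Definition subalgebra S : Prop :=
  [/\ S 1,
      forall (c : C) u v, S u -> S v -> S (c *: u + v)
    & forall u v, S u -> S v -> S (u * v)].

Definition gen_subalgebra G : set A := smallest subalgebra G.

Definition ideal_of S I : Prop :=
  [/\ (I `<=` S)%classic,
      I 0,
      forall u v, I u -> I v -> I (u + v),
      forall s u, S s -> I u -> I (s * u)
    & forall s u, S s -> I u -> I (u * s)].

Definition gen_ideal S G : set A := smallest (ideal_of S) G.

Definition set_add (P Q : set A) : set A := [set p + q | p in P & q in Q]%classic.

Definition commutator_sums S : set A := fun w =>
  exists (n : nat) (c d : 'I_n -> A),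
    (forall i, S (c i) /\ S (d i)) /\ w = \sum_i (c i * d i - d i * c i).

End Subsets.

Section SumsOfSquares.
Variables (C : numClosedFieldType) (A : starAlgType C).
Implicit Types (S P : set A).

Definition star_set P : set A := [set star u | u in P]%classic.

Definition SOS S : set A := fun a =>
  exists (n : nat) (u : 'I_n -> A),
    (forall i, S (u i)) /\ a = \sum_i star (u i) * u i.

Definition SOS_tilde S : set A := fun a =>
  S a /\ exists2 b, SOS S b & commutator_sums S (a - b).

End SumsOfSquares.

Section FreeAlgebra.
Variables (I : choiceType) (C : numClosedFieldType).

Definition free_alg : Type := malg (fmonom I) C.
HB.instance Definition _ := GRing.Lalgebra.on free_alg.

Let free_scalerAr (c : C) (f g : free_alg) : c *: (f * g) = f * (c *: g).
Proof.
suff E : mkmalgU (mone : fmonom I) c * f = f * mkmalgU (mone : fmonom I) c.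
  have E' h : c *: h = mkmalgU (mone : fmonom I) c * h by rewrite mul_malgC.
  by rewrite (E' (f * g)) (E' g) !mulrA E.
rewrite !malgM_def fgmulUg fgmulgU; apply: eq_bigr => k _.
by rewrite mulrC mul1m mulm1.
Qed.

HB.instance Definition _ := GRing.Lalgebra_isAlgebra.Build C free_alg
  free_scalerAr.

Definition free_gen (i : I) : free_alg := mkmalgU (fmu i) 1.

Definition fm_rev (m : fmonom I) : fmonom I := FMonom (rev m).

Definition free_star (f : free_alg) : free_alg :=
  \sum_(m <- msupp f) mkmalgU (fm_rev m) (mcoeff m f)^*.

Let fm_revK : involutive fm_rev.
Proof. by case=> s; rewrite /fm_rev /= revK. Qed.

Let fm_revM (m n : fmonom I) : fm_rev (mmul m n) = mmul (fm_rev n) (fm_rev m).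
Proof.
rewrite /fm_rev {1}/mmul /= fmmulE /= rev_cat.
by rewrite {1}/mmul /= fmmulE.
Qed.

Lemma mcoeff_free_star f m :
  mcoeff m (free_star f) = (mcoeff (fm_rev m) f)^*.
Proof.
rewrite /free_star raddf_sum /=.
rewrite (eq_bigr (fun k => (mcoeff k f)^* *+ (fm_rev k == m))); last first.
  by move=> k _; rewrite mcoeffU.
have E k : (fm_rev k == m) = (k == fm_rev m) by rewrite (can2_eq fm_revK fm_revK).
have [mf|mf] := boolP (fm_rev m \in msupp f).
  rewrite (big_fsetD1 _ mf) /= E eqxx mulr1n big1_fset ?addr0 // => k.
  by rewrite in_fsetD1 E => /andP[/negPf->].
rewrite big1_fset; first by rewrite mcoeff_outdom ?rmorph0.
by move=> k kf _; rewrite E; case: eqP kf mf => // -> ->.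
Qed.

Let free_starK : involutive free_star.
Proof.
by move=> f; apply/malgP => m; rewrite !mcoeff_free_star fm_revK conjCK.
Qed.

Let free_starD : {morph free_star : f g / f + g}.
Proof.
move=> f g; apply/malgP => m.
rewrite [in RHS]mcoeffD !mcoeff_free_star [in LHS]mcoeffD.
exact: rmorphD.
Qed.

Let free_starZ c f : free_star (c *: f) = c^* *: free_star f.
Proof.
apply/malgP => m; rewrite (mcoeffZ (R := C)) !mcoeff_free_star.
by rewrite (mcoeffZ (R := C)) rmorphM.
Qed.

Let free_star0 : free_star 0 = 0.
Proof. by apply: (addrI (free_star 0)); rewrite -free_starD !addr0. Qed.

Lemma free_starU m c : free_star (mkmalgU m c) = mkmalgU (fm_rev m) c^*.
Proof.
apply/malgP => k; rewrite mcoeff_free_star !mcoeffU.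
by rewrite rmorphMn /= (can2_eq fm_revK fm_revK).
Qed.

Let free_starM f g : free_star (f * g) = free_star g * free_star f.
Proof.
have sumE (J : Type) (r : seq J) (F : J -> free_alg) :
    free_star (\sum_(j <- r) F j) = \sum_(j <- r) free_star (F j).
  exact: (big_morph _ free_starD free_star0).
rewrite [f]monalgE [g]monalgE mulr_suml !sumE mulr_sumr.
apply: eq_bigr => k _; rewrite mulr_sumr sumE mulr_suml.
apply: eq_bigr => l _; rewrite !free_starU !malgM_def !fgmulUU free_starU.
by rewrite fm_revM rmorphM mulrC.
Qed.

HB.instance Definition _ := isStarAlgebra.Build C free_alg
  free_starK free_starD free_starZ free_starM.

Lemma star_free_gen i : star (free_gen i) = free_gen i.
Proof. by rewrite [LHS]free_starU rmorph1 /fm_rev /free_gen fmuE. Qed.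

End FreeAlgebra.

Section QuotientAlgebra.
Variables (C : numClosedFieldType) (A : starAlgType C).

(* 1 is required not to be in the ideal because algType excludes the zero
   ring. *)
Record star_ideal := StarIdeal {
  ideal_set :> A -> Prop;
  ideal_setP : ideal_of setT ideal_set;
  ideal_set1 : ~ ideal_set 1;
  ideal_set_star : forall u, ideal_set u -> ideal_set (star u)
}.

Variable J : star_ideal.

Definition ideal_pred : {pred A} := fun u => `[< J u >].

Let ideal_pred_closed : zmod_closed ideal_pred.
Proof.
have [_ J0 JD JMl _] := ideal_setP J.
split=> [|u v /asboolP Ju /asboolP Jv]; apply/asboolP => //.
by apply: JD => //; rewrite -mulN1r; apply: JMl.
Qed.
HB.instance Definition _ := GRing.isZmodClosed.Build A ideal_pred
  ideal_pred_closed.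

Definition quot_alg : Type := {ideal_quot (ideal_pred : zmodClosed A)}.
HB.instance Definition _ := GRing.Zmodule.on quot_alg.

Definition quot_proj (u : A) : quot_alg := \pi_quot_alg u.
Local Notation p := quot_proj.

Lemma quot_projP u v : p u = p v <-> J (u - v).
Proof.
rewrite /p; split=> [/eqP|H]; last apply/eqP; rewrite -Quotient.idealrBE.
  by move/asboolP.
by apply/asboolP.
Qed.

Let pE u v : J (u - v) -> p u = p v. Proof. by move/quot_projP. Qed.

Lemma quot_projK (x : quot_alg) : p (repr x) = x.
Proof. exact: reprK. Qed.

Let quotW (P : quot_alg -> Prop) : (forall u, P (p u)) -> forall x, P x.
Proof. by move=> H x; rewrite -(quot_projK x). Qed.

Let projD u v : p (u + v) = p u + p v. Proof. exact: Quotient.pi_add. Qed.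

Let Jrepr u : J (repr (p u) - u).
Proof. by apply/quot_projP; rewrite quot_projK. Qed.

Definition quot_one : quot_alg := p 1.
Definition quot_mul (x y : quot_alg) : quot_alg := p (repr x * repr y).
Definition quot_scale (c : C) (x : quot_alg) : quot_alg := p (c *: repr x).
Definition quot_star (x : quot_alg) : quot_alg := p (star (repr x)).

Let pM u v : quot_mul (p u) (p v) = p (u * v).
Proof.
have [_ J0 JD JMl JMr] := ideal_setP J.
apply: pE; rewrite -[X in X - _](addrNK (repr (p u) * v)) -mulrBr.
by rewrite -addrA -mulrBl; apply: JD; [apply: JMl|apply: JMr].
Qed.

Let pZ c u : quot_scale c (p u) = p (c *: u).
Proof.
have [_ J0 JD JMl JMr] := ideal_setP J.
by apply: pE; rewrite -scalerBr -mulr_algl; apply: JMl.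
Qed.

Let pS u : quot_star (p u) = p (star u).
Proof. by apply: pE; rewrite -starN -starD; apply: ideal_set_star. Qed.

Let qmulA : associative quot_mul.
Proof. by do 3!elim/quotW=> ?; rewrite !pM mulrA. Qed.
Let qmul1 : left_id quot_one quot_mul.
Proof. by elim/quotW=> ?; rewrite /quot_one pM mul1r. Qed.
Let qmulr1 : right_id quot_one quot_mul.
Proof. by elim/quotW=> ?; rewrite /quot_one pM mulr1. Qed.
Let qmulDl : left_distributive quot_mul +%R.
Proof. by do 3!elim/quotW=> ?; rewrite -projD !pM -projD mulrDl. Qed.
Let qmulDr : right_distributive quot_mul +%R.
Proof. by do 3!elim/quotW=> ?; rewrite -projD !pM -projD mulrDr. Qed.
Let qone0 : quot_one != 0.
Proof.
have -> : (0 : quot_alg) = p 0 by apply: (addrI (p 0)); rewrite -projD !addr0.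
by apply/eqP => /quot_projP; rewrite subr0; apply: ideal_set1.
Qed.
HB.instance Definition _ := GRing.Zmodule_isNzRing.Build quot_alg
  qmulA qmul1 qmulr1 qmulDl qmulDr qone0.

Let qscaleA a b x : quot_scale a (quot_scale b x) = quot_scale (a * b) x.
Proof. by elim/quotW: x => ?; rewrite !pZ scalerA. Qed.
Let qscale1 : left_id 1 quot_scale.
Proof. by elim/quotW=> ?; rewrite pZ scale1r. Qed.
Let qscaleDr : right_distributive quot_scale +%R.
Proof. by move=> c; do 2!elim/quotW=> ?; rewrite -projD !pZ -projD scalerDr. Qed.
Let qscaleDl x : {morph quot_scale^~ x : a b / a + b}.
Proof. by move=> a b; elim/quotW: x => ?; rewrite !pZ -projD scalerDl. Qed.
HB.instance Definition _ := GRing.Zmodule_isLmodule.Build C quot_alg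
  qscaleA qscale1 qscaleDr qscaleDl.

Let pME u v : p u * p v = p (u * v). Proof. exact: pM. Qed.
Let pZE c u : c *: p u = p (c *: u). Proof. exact: pZ. Qed.

Let qscaleAl (c : C) (x y : quot_alg) : c *: (x * y) = (c *: x) * y.
Proof.
elim/quotW: x => u; elim/quotW: y => v.
by rewrite (pZE c u) !pME (pZE c (u * v)) scalerAl.
Qed.
HB.instance Definition _ := GRing.Lmodule_isLalgebra.Build C quot_alg qscaleAl.

Let qscaleAr (c : C) (x y : quot_alg) : c *: (x * y) = x * (c *: y).
Proof.
elim/quotW: x => u; elim/quotW: y => v.
by rewrite (pZE c v) !pME (pZE c (u * v)) scalerAr.
Qed.
HB.instance Definition _ := GRing.Lalgebra_isAlgebra.Build C quot_alg qscaleAr.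

Let qstarK : involutive quot_star.
Proof. by elim/quotW=> u; rewrite !pS starK. Qed.
Let qstarD : {morph quot_star : x y / x + y}.
Proof. by do 2!elim/quotW=> ?; rewrite -projD !pS -projD starD. Qed.
Let qstarZ (c : C) (x : quot_alg) : quot_star (c *: x) = c^* *: quot_star x.
Proof.
by elim/quotW: x => u; rewrite (pZE c u) !pS (pZE _ (star u)) starZ.
Qed.
Let qstarM (x y : quot_alg) : quot_star (x * y) = quot_star y * quot_star x.
Proof.
elim/quotW: x => u; elim/quotW: y => v.
by rewrite pME !pS pME starM.
Qed.
HB.instance Definition _ := isStarAlgebra.Build C quot_alg
  qstarK qstarD qstarZ qstarM.

Lemma quot_projD u v : p (u + v) = p u + p v. Proof. exact: projD. Qed.
Lemma quot_proj1 : p 1 = 1. Proof. by []. Qed.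
Lemma quot_projM u v : p (u * v) = p u * p v. Proof. by rewrite pME. Qed.
Lemma quot_projZ c u : p (c *: u) = c *: p u. Proof. by rewrite pZE. Qed.
Lemma quot_proj_star u : p (star u) = star (p u). Proof. by rewrite -pS. Qed.

End QuotientAlgebra.

Record game := Game {
  qX : finType; qY : finType; aA : finType; aB : finType;
  qX_gt0 : (0 < #|qX|)%N;
  qY_gt0 : (0 < #|qY|)%N;
  aA_gt0 : (0 < #|aA|)%N;
  aB_gt0 : (0 < #|aB|)%N;
  score : qX -> qY -> aA -> aB -> bool
}.

Section MirrorGames.
Variables (G : game) (xi : qX G -> qY G) (eta : qY G -> qX G).

Definition mirror_game : Prop :=
  (forall (x : qX G) (a a' : aA G) (b : aB G), a != a' ->
     ~~ (score x (xi x) a b && score x (xi x) a' b)) /\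
  (forall (y : qY G) (a : aA G) (b b' : aB G), b != b' ->
     ~~ (score (eta y) y a b && score (eta y) y a b')).

(* These are E_{x,y}^a and E_{x,y}^b. *)
Definition winsB (x : qX G) (y : qY G) (a : aA G) : {set aB G} :=
  [set b | score x y a b]%SET.
Definition winsA (x : qX G) (y : qY G) (b : aB G) : {set aA G} :=
  [set a | score x y a b]%SET.

Definition regular : Prop :=
  (forall x, \bigcup_(a : aA G) winsB x (xi x) a = [set: aB G]%SET) /\
  (forall y, \bigcup_(b : aB G) winsA (eta y) y b = [set: aA G]%SET).

End MirrorGames.

Section GameRelations.
Variables (C : numClosedFieldType) (A : starAlgType C) (G : game).
Variables (p : qX G -> aA G -> A) (q : qY G -> aB G -> A).

Inductive game_relation : A -> Prop :=
| rel_comm x a y b : game_relation (p x a * q y b - q y b * p x a)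
| rel_idem1 x a : game_relation (p x a ^+ 2 - p x a)
| rel_idem2 y b : game_relation (q y b ^+ 2 - q y b)
| rel_orth1 x a a' : a != a' -> game_relation (p x a * p x a')
| rel_orth2 y b b' : b != b' -> game_relation (q y b * q y b')
| rel_sum1 x : game_relation (\sum_(a : aA G) p x a - 1)
| rel_sum2 y : game_relation (\sum_(b : aB G) q y b - 1).

Definition game_ideal : set A := gen_ideal setT game_relation.

Lemma game_idealP : ideal_of setT game_ideal.
Proof.
split=> [//|J [[_ ? _ _ _] _]//|u v Iu Iv J HJ|s u _ Iu J HJ|s u _ Iu J HJ];
  case: (HJ) => -[_ _ JD JMl JMr] _.
- by apply: JD; [exact: Iu|exact: Iv].
- by apply: JMl => //; exact: Iu.
- by apply: JMr => //; exact: Iu.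
Qed.

Let game_relation_ideal (u : A) : game_relation u -> game_ideal u.
Proof. by move=> Hu J [_]; apply. Qed.

Lemma game_ideal_star :
  (forall x a, star (p x a) = p x a) -> (forall y b, star (q y b) = q y b) ->
  forall u, game_ideal u -> game_ideal (star u).
Proof.
move=> sp sq u /(_ [set v | game_ideal (star v)]%classic); apply.
have [_ I0 ID IMl IMr] := game_idealP.
split.
  split=> [//||v w Iv Iw|s v _ Iv|s v _ Iv] /=.
  - by rewrite star0.
  - by rewrite starD; apply: ID.
  - by rewrite starM; apply: IMr.
  - by rewrite starM; apply: IMl.
move=> _ [x a y b|x a|y b|x a a' aa'|y b b' bb'|x|y] /=.
- rewrite starD starN !starM sp sq -opprB -mulN1r; apply: IMl => //.
  by apply: game_relation_ideal; apply: rel_comm.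
- rewrite starD starN expr2 starM sp.
  by apply: game_relation_ideal; apply: rel_idem1.
- rewrite starD starN expr2 starM sq.
  by apply: game_relation_ideal; apply: rel_idem2.
- rewrite starM !sp.
  by apply: game_relation_ideal; apply: rel_orth1; rewrite eq_sym.
- rewrite starM !sq.
  by apply: game_relation_ideal; apply: rel_orth2; rewrite eq_sym.
- rewrite starD starN star1 star_sum (eq_bigr (p x)) => [|//].
  by apply: game_relation_ideal; apply: rel_sum1.
- rewrite starD starN star1 star_sum (eq_bigr (q y)) => [|//].
  by apply: game_relation_ideal; apply: rel_sum2.
Qed.

(* The ideal is proper as soon as A has a character that is 0 or 1 on the
   generators, as for a deterministic strategy. *)
Lemma game_ideal_proper (chi : {rmorphism A -> C}) (a0 : aA G) (b0 : aB G) :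
  (forall x a, chi (p x a) = (a == a0)%:R) ->
  (forall y b, chi (q y b) = (b == b0)%:R) -> ~ game_ideal 1.
Proof.
move=> chi1 chi2.
have chi_sum (T : finType) (t0 : T) : \sum_(t : T) ((t == t0)%:R : C) = 1.
  by rewrite (bigD1 t0) //= eqxx big1 ?addr0 // => t /negPf->.
move=> /(_ [set v | chi v = 0]%classic) /=.
suff H : ideal_of setT [set v | chi v = 0]%classic /\
    (game_relation `<=` [set v | chi v = 0])%classic.
  by move=> /(_ H) /eqP; rewrite rmorph1 oner_eq0.
split.
  split=> [//||u v u0 v0|s u _ u0|s u _ u0] /=; first exact: rmorph0.
  - by rewrite rmorphD /= u0 v0 addr0.
  - by rewrite rmorphM /= u0 mulr0.
  - by rewrite rmorphM /= u0 mul0r.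
move=> _ [x a y b|x a|y b|x a a' aa'|y b b' bb'|x|y] /=.
- by rewrite rmorphB !rmorphM /= mulrC subrr.
- by rewrite rmorphB rmorphXn /= chi1; case: eqP; rewrite ?expr1n ?expr0n subrr.
- by rewrite rmorphB rmorphXn /= chi2; case: eqP; rewrite ?expr1n ?expr0n subrr.
- rewrite rmorphM /= !chi1.
  case: (eqVneq a a0) aa' => [-> aa'|_ _]; last by rewrite mul0r.
  by rewrite [a' == a0]eq_sym (negPf aa') mulr0.
- rewrite rmorphM /= !chi2.
  case: (eqVneq b b0) bb' => [-> bb'|_ _]; last by rewrite mul0r.
  by rewrite [b' == b0]eq_sym (negPf bb') mulr0.
- rewrite rmorphB rmorph_sum rmorph1 /= (eq_bigr _ (fun a _ => chi1 x a)).
  by rewrite chi_sum subrr.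
- rewrite rmorphB rmorph_sum rmorph1 /= (eq_bigr _ (fun b _ => chi2 y b)).
  by rewrite chi_sum subrr.
Qed.

End GameRelations.

Section FreeCharacter.
Variables (I : choiceType) (C : numClosedFieldType) (val : I -> C).

Let h (m : fmonom I) : C := \prod_(g <- (m : seq I)) val g.
Let hM : mmorphism h.
Proof.
split=> [m n|]; first by rewrite /h /mmul /= fmmulE /= big_cat.
by rewrite /h fm1 big_nil.
Qed.
HB.instance Definition _ := isMultiplicative.Build _ _ h hM.

Lemma free_character :
  exists chi : {rmorphism free_alg I C -> C}, forall i, chi (free_gen C i) = val i.
Proof.
exists (mmap idfun h : {rmorphism malg (fmonom I) C -> C}) => i.
by rewrite /= mmapU /= mul1r /h fmuE big_seq1.
Qed.

End FreeCharacter.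

Section GameAlgebra.
Variables (R : realType) (G : game).
Local Notation C := R[i].

Definition game_gen : Type := (qX G * aA G + qY G * aB G)%type.
HB.instance Definition _ := Finite.on game_gen.

Local Notation F := (free_alg game_gen C).

Definition fe1 (x : qX G) (a : aA G) : F := free_gen C (inl (x, a) : game_gen).
Definition fe2 (y : qY G) (b : aB G) : F := free_gen C (inr (y, b) : game_gen).

Lemma star_fe1 x a : star (fe1 x a) = fe1 x a. Proof. exact: star_free_gen. Qed.
Lemma star_fe2 y b : star (fe2 y b) = fe2 y b. Proof. exact: star_free_gen. Qed.

Lemma game_ideal1 : ~ game_ideal fe1 fe2 1.
Proof.
have /card_gt0P[a0 _] := aA_gt0 G.
have /card_gt0P[b0 _] := aB_gt0 G.
pose val (g : game_gen) : C :=
  match g with inl (_, a) => (a == a0)%:R | inr (_, b) => (b == b0)%:R end.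
have [chi chiE] := free_character val.
by apply: (@game_ideal_proper _ _ _ fe1 fe2 chi a0 b0) => [x a|y b]; exact: chiE.
Qed.

Definition game_star_ideal : star_ideal (free_alg game_gen C) :=
  StarIdeal (game_idealP fe1 fe2) game_ideal1 (game_ideal_star star_fe1 star_fe2).

Definition game_alg : Type := quot_alg game_star_ideal.
HB.instance Definition _ := StarAlgebra.on game_alg.

Local Notation U := game_alg.

Definition e1 (x : qX G) (a : aA G) : U := quot_proj game_star_ideal (fe1 x a).
Definition e2 (y : qY G) (b : aB G) : U := quot_proj game_star_ideal (fe2 y b).

Lemma star_e1 x a : star (e1 x a) = e1 x a.
Proof. by rewrite /e1 -[LHS]quot_proj_star star_fe1. Qed.
Lemma star_e2 y b : star (e2 y b) = e2 y b.
Proof. by rewrite /e2 -[LHS]quot_proj_star star_fe2. Qed.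

Definition U1 : set U := gen_subalgebra [set u | exists x a, u = e1 x a]%classic.
Definition U2 : set U := gen_subalgebra [set u | exists y b, u = e2 y b]%classic.

Definition Phi : U :=
  (#|qX G| * #|qY G|)%N%:R^-1 *:
  \sum_x \sum_y \sum_a \sum_b (score x y a b)%:R *: (e1 x a * e2 y b).

Definition f_mir (eta : qY G -> qX G) (y : qY G) (b : aB G) : U :=
  \sum_(a | score (eta y) y a b) e1 (eta y) a.
Definition g_mir (xi : qX G -> qY G) (x : qX G) (a : aA G) : U :=
  \sum_(b | score x (xi x) a b) e2 (xi x) b.

Definition J_mir1 (eta : qY G -> qX G) : set U :=
  gen_ideal U1 [set u | exists x y a b,
    ~~ score x y a b /\ u = e1 x a * f_mir eta y b]%classic.
Definition J_mir2 (xi : qX G -> qY G) : set U :=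
  gen_ideal U2 [set u | exists x y a b,
    ~~ score x y a b /\ u = e2 y b * g_mir xi x a]%classic.

End GameAlgebra.

(* A complex Hilbert space; the inner product is linear in its first
   argument. *)
Record hilbert (R : realType) := Hilbert {
  hspace :> completeNormedModType R[i];
  inner : {dot hspace for (@Num.conj R[i])};
  inner_norm : forall v : hspace, `|v| ^+ 2 = inner v v
}.

Definition bounded_op (R : realType) (H : hilbert R) (T : {linear H -> H}) :=
  exists M : R[i], forall v : H, `|T v| <= M * `|v|.

(* Unital star-homomorphisms from A to B(H); the last field says that
   rep (star u) is the adjoint of rep u. *)
Record star_rep (R : realType) (A : starAlgType R[i]) (H : hilbert R) := StarRep {
  rep :> A -> {linear H -> H};
  rep_bounded : forall u, bounded_op (rep u);
  rep_linear : forall (c : R[i]) u v (w : H),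
    rep (c *: u + v) w = c *: rep u w + rep v w;
  rep1 : forall w : H, rep 1 w = w;
  repM : forall u v (w : H), rep (u * v) w = rep u (rep v w);
  rep_star : forall u (w w' : H), inner H (rep u w) w' = inner H w (rep (star u) w')
}.

Definition has_perfect_strategy (R : realType) (G : game) : Prop :=
  exists (H : hilbert R) (pi : star_rep (game_alg R G) H) (psi : H),
    `|psi| = 1 /\ inner H (pi (Phi R G) psi) psi = 1.

(* Main.v *)
Require Import Defs.
From HB Require Import structures.
From mathcomp Require Import all_boot all_order all_algebra complex sesquilinear.
From mathcomp Require Import finmap boolp classical_sets functions reals topology.
From mathcomp Require Import normedtype.
From mathcomp Require Import -(notations) monalg.
From mathcomp Require Import ring lra.

(* If [psi] wins perfectly, then [e1 x a] and [g_mir xi x a] agree on [psi], and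
   so do [e2 y b] and [f_mir eta y b]; hence [u |-> <u psi, psi>] is a tracial
   state on [U1] that vanishes on [J_mir1], and no such state exists when
   [-1] lies in the cone.

   Conversely, [U1] is generated by projections, so [1] is an order unit of the
   cone of sums of squares modulo commutators and [J_mir1], and separating [-1]
   from that cone gives a tracial state [tau].  On the GNS space of [tau] let
   [e1 x a] act by left multiplication and [e2 y b] by right multiplication by
   [f_mir eta y b]: the two actions commute, and by the mirror and regularity
   conditions the [f_mir eta y b] form a projective measurement for each [y].
   The class of [1] is then a perfect vector, as [tau] kills
   [e1 x a * f_mir eta y b] whenever the score is 0.

   The argument only uses that the game algebra is generated by, and universal
   for, two commuting families of projective measurements, and this is
   symmetric in the two players. *)

Set Implicit Arguments.
Unset Strict Implicit.
Unset Printing Implicit Defensive.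

Import Order.TTheory GRing.Theory Num.Theory.
Local Open Scope ring_scope.

(** * Sequences converging at rate 1/n, and semi-inner products *)

(** Commutators enter the cone because of adjoints: for [<u, v> = tau (star v * u)], left
    multiplication by [p x a] is self-adjoint for any state, but for right multiplication by
    [mirror_sum y b] this comes from traciality. One player's algebra is only a subset of the game
    algebra. A retraction [r] onto it, which sends the other player's generators to the scalars 0
    and 1, lets the cone, the functional and the GNS space all live on the whole game algebra. The
    mirror ideal is not assumed star-invariant, and order arguments concern self-adjoint elements.
    So [u] is put in the cone according to [r u + star (r u)]; the separating functional [t] is
    real-linear, vanishes on anti-Hermitian elements, and is complexified afterwards. Separation
    uses no topology: Zorn's lemma gives a maximal cone, which induces a cut of the reals for each
    vector. The completion is a space of functionals, and limits carry an explicit rate [1/(n+1)],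
    so that its completeness reduces to suprema in [R]. *)

Section FastConvergence.
Variable R : realType.
Local Notation C := R[i].
Implicit Types (a b : nat -> C) (z w K e : C).

(** The shift gives [rate 0 = 1], so evaluating a bound [K * rate n] at 0 shows that [K] is
    nonnegative. *)
Definition rate (n : nat) : C := n.+1%:R^-1.

Lemma rate_gt0 n : 0 < rate n.
Proof. by rewrite invr_gt0 ltr0Sn. Qed.

Lemma rate_ge0 n : 0 <= rate n.
Proof. exact/ltW/rate_gt0. Qed.

Lemma rate_le1 n : rate n <= 1.
Proof. by rewrite invf_le1 ?ltr0Sn // ler1n. Qed.

Lemma rate_small e : 0 < e -> exists n, rate n <= e.
Proof.
move=> e0; have er : e \is Num.real by rewrite gtr0_real.
have [r er'] := complex_realP e er; subst e.
have r0 : 0 < r by rewrite -ltcR.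
exists (Num.truncn r^-1); rewrite /rate -[_%:R](rmorph_nat (real_complex R)).
rewrite -fmorphV lecR invf_ple ?posrE ?ltr0Sn //.
by rewrite ltW // truncnS_gt.
Qed.

Lemma le_small_eq0 z K : (forall e, 0 < e -> `|z| <= e * K) -> z = 0.
Proof.
move=> H; apply/eqP; rewrite -normr_eq0; apply/negPn/negP => z0.
have z_gt0 : 0 < `|z| by rewrite lt0r z0 /=.
have K0 : 0 < K.
  by have := H 1 ltr01; rewrite mul1r; apply: lt_le_trans.
(* With this [e] the hypothesis becomes [|z| <= |z| / 2]. *)
have /H : 0 < `|z| / (2 * K) by rewrite divr_gt0 // mulr_gt0 // ltr0Sn.
have -> : `|z| / (2 * K) * K = `|z| / 2 by field; rewrite gt_eqF.
by rewrite ler_pdivlMr ?ltr0Sn // ger_pMr // lern1.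
Qed.

Definition fast_cvg a z := exists K, forall n, `|a n - z| <= K * rate n.

Lemma fast_cvg_bound a z : fast_cvg a z ->
  exists2 K, 0 <= K & forall n, `|a n - z| <= K * rate n.
Proof.
case=> K aK; exists K => //; have := aK 0; rewrite /rate invr1 mulr1.
exact: le_trans.
Qed.

Lemma fast_cvg_const z : fast_cvg (fun=> z) z.
Proof. by exists 0 => n; rewrite subrr normr0 mul0r. Qed.

Lemma fast_cvg_lin c a b z w : fast_cvg a z -> fast_cvg b w ->
  fast_cvg (fun n => c * a n + b n) (c * z + w).
Proof.
move=> [K aK] [L bL]; exists (`|c| * K + L) => n.
have -> : c * a n + b n - (c * z + w) = c * (a n - z) + (b n - w) by ring.
rewrite (le_trans (ler_normD _ _)) // mulrDl lerD // normrM -mulrA.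
by rewrite ler_wpM2l.
Qed.

Lemma fast_cvg_conj a z : fast_cvg a z -> fast_cvg (fun n => (a n)^*) z^*.
Proof. by case=> K aK; exists K => n; rewrite -rmorphB norm_conjC. Qed.

Lemma fast_cvg_close a b z L : (forall n, `|b n - a n| <= L * rate n) ->
  fast_cvg a z -> fast_cvg b z.
Proof.
move=> ab [K aK]; exists (L + K) => n.
by rewrite -(subrKA (a n)) (le_trans (ler_normD _ _)) // mulrDl lerD.
Qed.

Lemma fast_cvg_uniq a z w : fast_cvg a z -> fast_cvg a w -> z = w.
Proof.
move=> /fast_cvg_bound[K K0 aK] [L aL]; apply/eqP; rewrite -subr_eq0; apply/eqP.
apply: (@le_small_eq0 _ (K + L)) => e e0; have [n ne] := rate_small e0.
rewrite -(subrKA (a n)) (le_trans (ler_normD _ _)) //.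
rewrite mulrDr lerD //.
  rewrite distrC (le_trans (aK n)) // mulrC ler_wpM2r //.
rewrite (le_trans (aL n)) // mulrC ler_wpM2r //.
by have := aL 0; rewrite /rate invr1 mulr1; apply: le_trans.
Qed.

Lemma fast_cvg_norm a z : fast_cvg a z -> fast_cvg (fun n => `|a n|) `|z|.
Proof.
by case=> K aK; exists K => n; rewrite (le_trans (ler_dist_dist _ _)).
Qed.

(** The sequence equals its own modulus, so it tends to both [z] and [|z|]; uniqueness of the limit
    gives realness and sign at once. *)
Lemma fast_cvg_ge0 a z : (forall n, 0 <= a n) -> fast_cvg a z -> 0 <= z.
Proof.
move=> a0 az; suff -> : z = `|z| by [].
apply: (fast_cvg_uniq az).
by have := fast_cvg_norm az; under eq_fun do rewrite ger0_norm //.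
Qed.

(** The limit is the supremum of the lower bounds [x n - K/(n+1)]. By [bd] each of them is below
    every upper bound [x m + K/(m+1)], which yields the rate on both sides. *)
Let real_complete (x : nat -> R) (K : R) :
  (forall n m, `|x n - x m| <= K * (n.+1%:R^-1 + m.+1%:R^-1)) ->
  exists s, forall n, `|x n - s| <= K * n.+1%:R^-1.
Proof.
move=> xK; pose E := range (fun n => x n - K * n.+1%:R^-1).
have bd n m : x n - K * n.+1%:R^-1 <= x m + K * m.+1%:R^-1.
  have := xK n m; rewrite ler_norml => /andP[_]; rewrite mulrDr.
  by move: (K * n.+1%:R^-1) (K * m.+1%:R^-1) => u v ?; lra.
have hsE : has_sup E.
  split; first by exists (x 0%N - K * 1%:R^-1); exists 0%N.
  by exists (x 0%N + K * 1%:R^-1) => _ [n _ <-]; exact: bd.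
exists (sup E) => n; rewrite ler_norml; apply/andP; split.
  rewrite lerBrDr addrC lerBlDr; apply: ge_sup; first by case: hsE.
  by move=> _ [m _ <-]; exact: bd.
rewrite lerBlDr -lerBlDl; apply: sup_upper_bound => //.
by exists n.
Qed.

Lemma normC_ge_Re z : `|complex.Re z|%:C%C <= `|z|.
Proof.
rewrite normc_def lecR -sqrtr_sqr ler_sqrt ?lerDl ?sqr_ge0 //.
by rewrite addr_ge0 ?sqr_ge0.
Qed.

Lemma normC_ge_Im z : `|complex.Im z|%:C%C <= `|z|.
Proof.
rewrite normc_def lecR -sqrtr_sqr ler_sqrt ?lerDr ?sqr_ge0 //.
by rewrite addr_ge0 ?sqr_ge0.
Qed.

Lemma fast_cauchy_cvg a K :
  (forall n m, `|a n - a m| <= K * (rate n + rate m)) ->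
  exists z, fast_cvg a z.
Proof.
move=> aK.
have K0 : 0 <= K.
  have := aK 0 0; rewrite /rate invr1 => /(le_trans (normr_ge0 _)).
  by rewrite pmulr_lge0 // addr_gt0.
have [k Kk] := complex_realP K (ger0_real K0); subst K.
have rateE n : rate n = (n.+1%:R^-1)%:C%C.
  by rewrite fmorphV rmorph_nat.
have [s sP] : exists s, forall n, `|complex.Re (a n) - s| <= k * n.+1%:R^-1.
  apply: real_complete => n m; rewrite -lecR rmorphM rmorphD /= -!rateE.
  by apply: le_trans (aK n m); rewrite -raddfB; exact: normC_ge_Re.
have [t tP] : exists t, forall n, `|complex.Im (a n) - t| <= k * n.+1%:R^-1.
  apply: real_complete => n m; rewrite -lecR rmorphM rmorphD /= -!rateE.
  by apply: le_trans (aK n m); rewrite -raddfB; exact: normC_ge_Im.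
(* The real and the imaginary part each contribute an error [k * rate n]. *)
exists (s +i* t)%C, (2 * k%:C%C) => n.
have -> : a n - (s +i* t)%C =
    (complex.Re (a n) - s)%:C%C + 'i%C * (complex.Im (a n) - t)%:C%C.
  by case: (a n) => x y; simpc.
rewrite (le_trans (ler_normD _ _)) // normrM.
have -> : `|'i%C : C| = 1 by rewrite normc_def /= expr0n add0r expr1n sqrtr1.
rewrite mul1r mulr_natl mulr2n mulrDl rateE !normc_def /= expr0n !addr0 !sqrtr_sqr.
by rewrite -!rmorphM lerD // lecR.
Qed.

End FastConvergence.

(** Definiteness is not asked for: the GNS form of a tracial state may have null vectors. *)
Record psd_form (C : numClosedFieldType) (V : lmodType C) := PsdForm {
  pform :> V -> V -> C;
  pform_linear : forall c u v w, pform (c *: u + v) w = c * pform u w + pform v w;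
  pform_herm : forall u v, pform u v = (pform v u)^*;
  pform_ge0 : forall u, 0 <= pform u u
}.

Section PsdTheory.
Variables (C : numClosedFieldType) (V : lmodType C) (k : psd_form V).
Implicit Types (u v w : V) (c e : C).

Lemma pform0l w : k 0 w = 0.
Proof.
have := pform_linear k (-1) 0 0 w.
by rewrite scaler0 add0r mulN1r addNr.
Qed.

Lemma pformDl u v w : k (u + v) w = k u w + k v w.
Proof. by have := pform_linear k 1 u v w; rewrite scale1r mul1r. Qed.

Lemma pformZl c u w : k (c *: u) w = c * k u w.
Proof. by have := pform_linear k c u 0 w; rewrite pform0l !addr0. Qed.

Lemma pformBl u v w : k (u - v) w = k u w - k v w.
Proof. by rewrite pformDl -scaleN1r pformZl mulN1r. Qed.

Lemma pformDr u v w : k w (u + v) = k w u + k w v.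
Proof. by rewrite pform_herm pformDl rmorphD /= -!pform_herm. Qed.

Lemma pformZr c u w : k w (c *: u) = c^* * k w u.
Proof. by rewrite pform_herm pformZl rmorphM /= -pform_herm. Qed.

Lemma pformBr u v w : k w (u - v) = k w u - k w v.
Proof. by rewrite pform_herm pformBl rmorphB /= -!pform_herm. Qed.

(** If [k v v > 0], positivity at [k v v *: u - k u v *: v] suffices, and the case [k u u > 0] is
    symmetric. If both vanish, positivity at [u - k u v *: v] says that [-2 |k u v|^2 >= 0]. *)
Lemma pform_cauchy_schwarz u v : `|k u v| ^+ 2 <= k u u * k v v.
Proof.
have pos u1 v1 : 0 < k v1 v1 -> `|k u1 v1| ^+ 2 <= k u1 u1 * k v1 v1.
  move=> a0; have := pform_ge0 k (k v1 v1 *: u1 - k u1 v1 *: v1).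
  rewrite !(pformBl, pformBr, pformZl, pformZr) (pform_herm k v1 u1).
  rewrite (geC0_conj (ltW a0)) normCK.
  set a := k v1 v1 in a0 *; set c := k u1 v1; set b := k u1 u1.
  have -> : a * (a * b - c^* * c) - c * (a * c^* - c^* * a) =
    a * (b * a - c * c^*) by ring.
  by rewrite pmulr_rge0 // subr_ge0.
have := pform_ge0 k v; rewrite le0r => /orP[/eqP v0|]; last exact: pos.
have := pform_ge0 k u; rewrite le0r => /orP[/eqP u0|]; last first.
  by move=> /(pos v u); rewrite (pform_herm k v u) norm_conjC mulrC.
have := pform_ge0 k (u - k u v *: v).
rewrite !(pformBl, pformBr, pformZl, pformZr) (pform_herm k v u) u0 v0.
rewrite normCK mulr0 !mulr0 subr0 sub0r; set c := k u v.
rewrite [c^* * c]mulrC -opprD oppr_ge0 => H.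
have cc0 : 0 <= c * c^* by rewrite mul_conjC_ge0.
by apply: le_trans H; rewrite lerDl.
Qed.

Definition pnorm u : C := sqrtC (k u u).

Lemma pnorm_ge0 u : 0 <= pnorm u.
Proof. by rewrite sqrtC_ge0 pform_ge0. Qed.

Lemma pnorm_sqr u : pnorm u ^+ 2 = k u u.
Proof. exact: sqrtCK. Qed.

Lemma pform_le u v : `|k u v| <= pnorm u * pnorm v.
Proof.
rewrite -(@ler_pXn2r _ 2%N) // ?nnegrE ?mulr_ge0 ?pnorm_ge0 //.
by rewrite exprMn !pnorm_sqr pform_cauchy_schwarz.
Qed.

Lemma pnormD u v : pnorm (u + v) <= pnorm u + pnorm v.
Proof.
rewrite -(@ler_pXn2r _ 2%N) // ?nnegrE ?addr_ge0 ?pnorm_ge0 //.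
rewrite sqrrD !pnorm_sqr pformDl !pformDr (pform_herm k v u).
have -> : k u u + k u v + ((k u v)^* + k v v) =
  k u u + (k u v + (k u v)^*) + k v v by ring.
rewrite lerD2r lerD2l.
have re : k u v + (k u v)^* \is Num.real by rewrite CrealE rmorphD /= conjCK addrC.
rewrite (le_trans (real_ler_norm re)) // (le_trans (ler_normD _ _)) //.
by rewrite norm_conjC mulr2n lerD // pform_le.
Qed.

Lemma pnormZ c u : pnorm (c *: u) = `|c| * pnorm u.
Proof.
apply/eqP; rewrite -(@eqrXn2 _ 2%N) ?mulr_ge0 ?pnorm_ge0 //.
by rewrite exprMn !pnorm_sqr pformZl pformZr normCK mulrA.
Qed.

Lemma pnorm_dist u v : pnorm u <= pnorm v + pnorm (u - v).
Proof. by rewrite -{1}(subrK v u) addrC pnormD. Qed.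

End PsdTheory.

(** * Completion of a semi-inner product space *)

Section Completion.
Variables (R : realType) (V : lmodType R[i]) (k : psd_form V).
Local Notation C := R[i].
Local Notation n := (pnorm k).
Implicit Types (u v w : V) (g : V -> C^o) (c e : C).

(* The completion consists of the bounded antilinear functionals [g] on [V]
   that are limits of functionals [k v]. *)
Definition approx g v e := forall w, `|(g w : C) - k v w| <= e * n w.
Definition approximable g := forall e, 0 < e -> exists v, approx g v e.

Lemma approx_pform v : approx (k v) v 0.
Proof. by move=> w; rewrite subrr normr0 mul0r. Qed.

Lemma approx_lin c g1 g2 v1 v2 e1 e2 : approx g1 v1 e1 -> approx g2 v2 e2 ->
  approx (c *: g1 + g2) (c *: v1 + v2) (`|c| * e1 + e2).
Proof.
move=> H1 H2 w; rewrite pform_linear.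
have -> : (c *: g1 + g2) w = c * (g1 w : C) + (g2 w : C) :> C by [].
have -> : c * (g1 w : C) + g2 w - (c * k v1 w + k v2 w) =
  c * ((g1 w : C) - k v1 w) + ((g2 w : C) - k v2 w) by ring.
rewrite (le_trans (ler_normD _ _)) // normrM mulrDl -mulrA lerD //.
by rewrite ler_wpM2l.
Qed.

Lemma approxW g v e e' : e <= e' -> approx g v e -> approx g v e'.
Proof.
by move=> ee H w; rewrite (le_trans (H w)) // ler_wpM2r // pnorm_ge0.
Qed.

Lemma pnorm_le u e : 0 <= e -> (forall w, `|k u w| <= e * n w) -> n u <= e.
Proof.
move=> e0 /(_ u); rewrite -pnorm_sqr ger0_norm ?exprn_ge0 ?pnorm_ge0 // expr2.
have := pnorm_ge0 k u; rewrite le0r => /orP[/eqP->//|n0].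
by rewrite ler_pM2r.
Qed.

Lemma approx_dist g v v' e e' : 0 <= e -> 0 <= e' ->
  approx g v e -> approx g v' e' -> n (v - v') <= e + e'.
Proof.
move=> e0 e0' H H'; apply: pnorm_le; first exact: addr_ge0.
move=> w; rewrite pformBl -(subrKA (g w : C)) (le_trans (ler_normD _ _)) //.
by rewrite mulrDl lerD // distrC.
Qed.

Definition completion_pred : {pred V -> C^o} := fun g => `[< approximable g >].

Fact completion_submod : submod_closed completion_pred.
Proof.
split=> [|c g1 g2 /asboolP H1 /asboolP H2]; apply/asboolP => e e0.
  by exists 0 => w; rewrite pform0l subrr normr0 mulr_ge0 ?pnorm_ge0 // ltW.
have c0 : 0 < 2 * (1 + `|c|) by rewrite mulr_gt0 ?ltr0Sn // ltr_pwDl.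
have [v1 a1] := H1 (e / (2 * (1 + `|c|))) (divr_gt0 e0 c0).
have [v2 a2] := H2 (e / 2) (divr_gt0 e0 (ltr0Sn _ _)).
exists (c *: v1 + v2); apply: approxW (approx_lin c a1 a2).
rewrite [leRHS](_ : e = e / 2 + e / 2); last by field.
rewrite lerD2r.
have c1 : 1 + `|c| != 0 by rewrite gt_eqF // ltr_pwDl.
have -> : `|c| * (e / (2 * (1 + `|c|))) = e / 2 * (`|c| / (1 + `|c|)).
  by field.
apply: ler_piMr; first exact/ltW/divr_gt0.
by rewrite ler_pdivrMr ?ltr_pwDl // mul1r lerDr.
Qed.

HB.instance Definition _ := GRing.isSubmodClosed.Build C (V -> C^o) completion_pred
  completion_submod.

Record completion := Completion {
  cfun :> V -> C^o;
  _ : cfun \in completion_pred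
}.
HB.instance Definition _ := [isSub for cfun].
HB.instance Definition _ := [Choice of completion by <:].
HB.instance Definition _ := [SubChoice_isSubLmodule of completion by <:].

Implicit Types f : completion.

Lemma cfun_approx f : approximable f.
Proof. by case: f => g /= /asboolP. Qed.

Lemma cfunB f1 f2 w : (f1 - f2) w = (f1 w : C) - f2 w :> C.
Proof. by []. Qed.

Lemma cfun_inj f1 f2 : (forall w, f1 w = f2 w :> C) -> f1 = f2.
Proof. by move=> H; apply: val_inj; apply/funext. Qed.

Definition apx f (m : nat) : V := sval (cid (cfun_approx f (rate_gt0 R m))).

Lemma apxP f m : approx f (apx f m) (rate R m).
Proof. by rewrite /apx; case: cid. Qed.

Lemma apx_dist f l m : n (apx f l - apx f m) <= rate R l + rate R m.
Proof. by apply: (@approx_dist f); rewrite ?rate_ge0 //; apply: apxP. Qed.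

Lemma apx_bound f m : n (apx f m) <= n (apx f 0) + 2.
Proof.
rewrite (le_trans (pnorm_dist k _ (apx f 0))) // lerD2l.
by rewrite (le_trans (apx_dist f m 0)) // mulr2n lerD // rate_le1.
Qed.

(** A point of the completion is only known to be approximable; additivity is inherited from the
    functionals [k u] that approximate it. *)
Lemma cfunBr f v w : (f v : C) - f w = f (v - w).
Proof.
apply/eqP; rewrite -subr_eq0; apply/eqP.
apply: (@le_small_eq0 _ _ (n v + n w + n (v - w))) => e e0.
have [u au] := cfun_approx f e0.
have -> : (f v : C) - f w - f (v - w) =
   ((f v : C) - k u v) - ((f w : C) - k u w) - ((f (v - w) : C) - k u (v - w)).
  by rewrite pformBr; ring.
rewrite (le_trans (ler_normB _ _)) // mulrDr lerD //.
by rewrite (le_trans (ler_normB _ _)) // mulrDr lerD.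
Qed.

Lemma cfun_bounded f : exists2 M, 0 <= M & forall w, `|f w : C| <= M * n w.
Proof.
exists (n (apx f 0) + 1) => [|w]; first by rewrite addr_ge0 ?pnorm_ge0.
rewrite -[f w : C](subrK (k (apx f 0) w)) (le_trans (ler_normD _ _)) //.
rewrite mulrDl addrC lerD ?pform_le // (le_trans (apxP f 0 w)) //.
by rewrite /rate invr1.
Qed.

Fact cdot_subproof f (g : completion) : exists z, fast_cvg (fun m => f (apx g m) : C) z.
Proof.
have [M M0 fM] := cfun_bounded f.
apply: (@fast_cauchy_cvg _ _ M) => l m.
by rewrite cfunBr (le_trans (fM _)) // ler_wpM2l // apx_dist.
Qed.

(** A functional [f] stands for [<f, .>], so its product with [g] is the limit of [f] along vectors
    approximating [g]. *)
Definition cdot f (g : completion) : C := sval (cid (cdot_subproof f g)).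

Lemma cdot_apx f (g : completion) : fast_cvg (fun m => f (apx g m) : C) (cdot f g).
Proof. by rewrite /cdot; case: cid. Qed.

(** Independence from the chosen approximants [apx g]; this frees the computation of adjoints and of
    products with embedded vectors from that choice. *)
Lemma cdotP f (g : completion) (v : nat -> V) M : 0 <= M ->
  (forall m, approx g (v m) (M * rate R m)) ->
  fast_cvg (fun m => f (v m) : C) (cdot f g).
Proof.
move=> M0 gv; have [L L0 fL] := cfun_bounded f.
apply: (@fast_cvg_close _ _ _ _ (L * (M + 1))) (cdot_apx f g) => m.
rewrite cfunBr (le_trans (fL _)) // -mulrA ler_wpM2l // mulrDl mul1r.
by apply: (@approx_dist g); rewrite ?mulr_ge0 ?rate_ge0 //; apply: apxP.
Qed.

Lemma cdot_lin c f1 f2 (g : completion) : cdot (c *: f1 + f2) g = c * cdot f1 g + cdot f2 g.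
Proof.
apply: (fast_cvg_uniq (cdot_apx (c *: f1 + f2) g)).
exact: (fast_cvg_lin c (cdot_apx f1 g) (cdot_apx f2 g)).
Qed.

(** Both [f (apx g m)] and the conjugate of [g (apx f m)] are within a multiple of [rate m] of
    [k (apx f m) (apx g m)]. *)
Lemma cdot_herm f (g : completion) : cdot f g = (cdot g f)^*.
Proof.
apply: (fast_cvg_uniq (cdot_apx f g)).
apply: fast_cvg_close (fast_cvg_conj (cdot_apx g f)) => m.
rewrite -(subrKA (k (apx f m) (apx g m))) (le_trans (ler_normD _ _)) //.
rewrite {2}pform_herm -rmorphB norm_conjC [X in _ + X]distrC.
have Ef : `|(f (apx g m) : C) - k (apx f m) (apx g m)| <= (n (apx g 0) + 2) * rate R m.
  rewrite (le_trans (apxP f m _)) // mulrC ler_wpM2r ?rate_ge0 //.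
  exact: apx_bound.
have Eg : `|(g (apx f m) : C) - k (apx g m) (apx f m)| <= (n (apx f 0) + 2) * rate R m.
  rewrite (le_trans (apxP g m _)) // mulrC ler_wpM2r ?rate_ge0 //.
  exact: apx_bound.
rewrite (le_trans (lerD Ef Eg)) // -mulrDl.
exact: lexx.
Qed.

Lemma cdot_self f : fast_cvg (fun m => k (apx f m) (apx f m)) (cdot f f).
Proof.
apply: fast_cvg_close (cdot_apx f f) => m; rewrite distrC.
rewrite (le_trans (apxP f m _)) // mulrC ler_wpM2r ?rate_ge0 //.
exact: apx_bound.
Qed.

Lemma cdot_ge0 f : 0 <= cdot f f.
Proof. by apply: fast_cvg_ge0 (cdot_self f) => m; apply: pform_ge0. Qed.

Definition cdot_psd : psd_form completion := PsdForm cdot_lin cdot_herm cdot_ge0.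

Fact cembed_subproof v : (k v : V -> C^o) \in completion_pred.
Proof.
by apply/asboolP => e e0; exists v; apply: approxW (approx_pform v); apply: ltW.
Qed.

Definition cembed v : completion := Completion (cembed_subproof v).

Lemma cdot_cembed f v : cdot f (cembed v) = f v.
Proof.
apply: fast_cvg_uniq (fast_cvg_const (f v : C)).
apply: (@cdotP f (cembed v) (fun=> v) 0) => // m; rewrite mul0r.
exact: approx_pform.
Qed.

(** Here the null vectors of [k] disappear: the values [f w] are the products of [f] with embedded
    vectors, and Cauchy-Schwarz makes them all 0. *)
Lemma cdot_eq0 f : cdot f f = 0 -> f = 0.
Proof.
move=> f0; apply: cfun_inj => w; apply/eqP; rewrite -normr_eq0 eq_le normr_ge0 andbT.
rewrite -(cdot_cembed f w) (le_trans (pform_le cdot_psd f _)) //.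
by rewrite {1}/pnorm /= f0 sqrtC0 mul0r.
Qed.

Local Notation N := (pnorm cdot_psd).

Lemma cnorm_cembed v : N (cembed v) = n v.
Proof. by rewrite /pnorm /= cdot_cembed. Qed.

(** The difference [g] is a functional bounded by [e], so its approximants have norm at most
    [e + rate m], and [cdot g g] is the limit of their squared norms. *)
Lemma cnorm_approx f v e : 0 <= e -> approx f v e -> N (f - cembed v) <= e.
Proof.
move=> e0 fv; set g := f - cembed v.
have ge w : `|g w : C| <= e * n w by exact: fv.
have nge m : n (apx g m) <= e + rate R m.
  apply: pnorm_le => [|w]; first by rewrite addr_ge0 ?rate_ge0.
  rewrite -[k _ w](subKr (g w : C)) (le_trans (ler_normB _ _)) // mulrDl lerD //.
  exact: apxP.
rewrite -(@ler_pXn2r _ 2%N) // ?nnegrE ?pnorm_ge0 // pnorm_sqr /=.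
have sq_cvg : fast_cvg (fun m => (e + rate R m) ^+ 2) (e ^+ 2).
  apply: (@fast_cvg_close _ _ _ _ (e + e + 1)) (fast_cvg_const (e ^+ 2)) => m.
  have -> : (e + rate R m) ^+ 2 - e ^+ 2 = (e + e + rate R m) * rate R m by ring.
  have er : 0 <= e + e + rate R m by rewrite !addr_ge0 ?rate_ge0.
  rewrite ger0_norm ?mulr_ge0 ?rate_ge0 //.
  by rewrite ler_wpM2r ?rate_ge0 // lerD2l rate_le1.
rewrite -subr_ge0 addrC -mulN1r.
apply: fast_cvg_ge0 (fast_cvg_lin (-1) (cdot_self g) sq_cvg) => m.
rewrite mulN1r addrC subr_ge0 -pnorm_sqr ler_pXn2r // nnegrE ?pnorm_ge0 //.
by rewrite addr_ge0 ?rate_ge0.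
Qed.

Lemma cembed_dense f e : 0 < e -> exists v, N (f - cembed v) <= e.
Proof.
move=> e0; have [v fv] := cfun_approx f e0; exists v.
by apply: cnorm_approx fv; apply: ltW.
Qed.

Lemma cnorm_eq0 f : N f = 0 -> f = 0.
Proof.
by have := pnorm_sqr cdot_psd f => /= + f0; rewrite f0 expr0n => /esym/cdot_eq0.
Qed.

HB.instance Definition _ := Lmodule_isNormed.Build C completion
  (pnormD cdot_psd) (pnormZ cdot_psd) cnorm_eq0.

Lemma cnormE f : `|f| = N f.
Proof. by []. Qed.

(** The filter is replaced by vectors [v m] of [V] such that the ball of radius [rate m] around the
    image of [v m] belongs to [F]. The limit is the pointwise limit [g] of the functionals
    [k (v m)]. *)
Lemma completion_complete (F : set_system completion) :
  ProperFilter F -> cauchy F -> cvg F.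
Proof.
move=> FF /cauchyP Fc.
have near_embed m : {v | F (ball (cembed v) (rate R m))}.
  apply: cid; have r2 : 0 < rate R m / 2 by rewrite divr_gt0 ?rate_gt0 ?ltr0Sn.
  have [f Ff] := Fc _ r2; have [v fv] := cembed_dense f r2; exists v.
  apply: filterS Ff => g; rewrite -!ball_normE /ball_ /= => fg.
  rewrite -(subrKA f) (le_lt_trans (ler_normD _ _)) //.
  rewrite [ltRHS](_ : _ = rate R m / 2 + rate R m / 2); last by field.
  by rewrite ler_ltD // distrC.
pose v m := sval (near_embed m).
have vP m : F (ball (cembed (v m)) (rate R m)) by rewrite /v; case: (near_embed m).
(* Two members of a proper filter meet; a common point of the two balls bounds the distance. *)
have vdist l m : n (v l - v m) <= rate R l + rate R m.
  have [f []] := filter_ex (filterI (vP l) (vP m)).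
  rewrite -!ball_normE /ball_ /= => fl fm.
  have -> : n (v l - v m) = `|cembed (v l) - cembed (v m)|.
    rewrite -cnorm_cembed cnormE; congr N; apply: cfun_inj => w.
    by rewrite cfunB /= pformBl.
  rewrite -(subrKA f) (le_trans (ler_normD _ _)) // lerD // ltW //.
  by rewrite distrC.
have lim_ex w : {z : C | fast_cvg (fun m => k (v m) w) z}.
  apply: cid; apply: (@fast_cauchy_cvg _ _ (n w)) => l m.
  rewrite -pformBl (le_trans (pform_le k _ _)) // mulrC.
  by rewrite ler_wpM2l ?pnorm_ge0.
pose g : V -> C^o := fun w => sval (lim_ex w).
have gP w : fast_cvg (fun m => k (v m) w) (g w) by rewrite /g; case: (lim_ex w).
(* Let [l] tend to infinity in [|k (v m - v l) w| <= (rate m + rate l) * n w]. *)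
have gv m : approx g (v m) (rate R m).
  move=> w; rewrite distrC.
  pose b l := (rate R m + rate R l) * n w.
  have bcvg : fast_cvg b (rate R m * n w).
    apply: (@fast_cvg_close _ _ _ _ (n w)) (fast_cvg_const _) => l.
    rewrite /b -mulrBl addrC addKr ger0_norm ?mulr_ge0 ?rate_ge0 ?pnorm_ge0 //.
    by rewrite mulrC.
  have := fast_cvg_norm (fast_cvg_lin (-1) (gP w) (fast_cvg_const (k (v m) w))).
  rewrite mulN1r addrC => /(fast_cvg_lin (-1)) /(_ bcvg) H.
  rewrite -subr_ge0 addrC -mulN1r.
  apply: fast_cvg_ge0 H => l; rewrite !mulN1r addrC subr_ge0 /b addrC -pformBl.
  rewrite (le_trans (pform_le k _ _)) // ler_wpM2r ?pnorm_ge0 //.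
have g_approx : g \in completion_pred.
  apply/asboolP => e e0; have [m me] := rate_small e0; exists (v m).
  exact: approxW (gv m).
apply/cvg_ex; exists (Completion g_approx); apply/fcvgrPdist_lt => e e0.
have e2 : 0 < e / 2 by rewrite divr_gt0 ?ltr0Sn.
have [m me] := rate_small e2.
apply: filterS (vP m) => f; rewrite -ball_normE /ball_ /= => vf.
rewrite -(subrKA (cembed (v m))) (le_lt_trans (ler_normD _ _)) //.
rewrite [ltRHS](_ : _ = e / 2 + e / 2); last by field.
rewrite ler_ltD //; last exact: lt_le_trans me.
by rewrite (le_trans _ me) // cnormE cnorm_approx // rate_ge0.
Qed.

HB.instance Definition _ := Uniform_isComplete.Build completion completion_complete.

End Completion.

(** * The completion as a Hilbert space *)

Section HilbertCompletion.
Variables (R : realType) (V : lmodType R[i]) (k : psd_form V).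
Local Notation C := R[i].
Local Notation H := (completion k).
Local Notation cdot := (@cdot R V k).

Fact cdot_bilinear : bilinear_for *%R (Num.conj \; *%R) cdot.
Proof.
split=> [f c f1 f2|f c f1 f2] /=; first exact: cdot_lin.
rewrite (cdot_herm f (_ + _)) cdot_lin rmorphD rmorphM /=.
by rewrite -!(cdot_herm f).
Qed.

HB.instance Definition _ := bilinear_isBilinear.Build C H H C *%R
  (Num.conj \; *%R) cdot cdot_bilinear.

Fact cdot_hermitian (f g : H) : cdot f g = (-1) ^+ false * (cdot g f)^*.
Proof. by rewrite expr0 mul1r; exact: cdot_herm. Qed.

HB.instance Definition _ := isHermitianSesquilinear.Build C H false Num.conj cdot
  cdot_hermitian.

Fact cdot_gt0 (f : H) : f != 0 -> 0 < cdot f f.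
Proof.
move=> f0; rewrite lt0r cdot_ge0 andbT; apply: contraNneq f0.
by move=> /cdot_eq0 ->.
Qed.

HB.instance Definition _ := isDotProduct.Build C H cdot cdot_gt0.

Fact cdot_norm (f : H) : `|f| ^+ 2 = cdot f f.
Proof. by rewrite cnormE pnorm_sqr. Qed.

Definition hilbert_completion : hilbert R :=
  @Hilbert R H cdot cdot_norm.

End HilbertCompletion.

(** * Extension of a bounded star-action to the completion *)

Section ExtendAction.
Variables (R : realType) (A : starAlgType R[i]) (V : lmodType R[i]).
Variables (k : psd_form V) (L : A -> V -> V).
Local Notation C := R[i].
Local Notation n := (pnorm k).
Hypothesis L_lin : forall c u v w, L (c *: u + v) w = c *: L u w + L v w.
Hypothesis L1 : forall w, L 1 w = w.
Hypothesis LM : forall u v w, L (u * v) w = L u (L v w).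
Hypothesis L_adj : forall u v w, k (L u v) w = k v (L (star u) w).
Hypothesis L_bounded : forall u, exists2 M, 0 <= M & forall v, n (L u v) <= M * n v.

Local Notation H := (completion k).

Lemma cfun_antilinear (f : H) c v w : f (c *: v + w) = c^* * (f v : C) + f w :> C.
Proof.
apply/eqP; rewrite -subr_eq0; apply/eqP.
apply: (@le_small_eq0 _ _ (n (c *: v + w) + `|c| * n v + n w)) => e e0.
have [u au] := cfun_approx f e0.
have -> : (f (c *: v + w) : C) - (c^* * (f v : C) + f w) =
   ((f (c *: v + w) : C) - k u (c *: v + w)) - c^* * ((f v : C) - k u v)
     - ((f w : C) - k u w).
  by rewrite pformDr pformZr; ring.
rewrite (le_trans (ler_normB _ _)) // [leRHS]mulrDr lerD //.
rewrite (le_trans (ler_normB _ _)) // [leRHS]mulrDr lerD // normrM norm_conjC mulrCA.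
by rewrite ler_wpM2l.
Qed.

Lemma approx_act u (f : H) v e M : 0 <= e ->
  (forall w, n (L (star u) w) <= M * n w) ->
  approx k f v e -> approx k (fun w => f (L (star u) w)) (L u v) (e * M).
Proof.
move=> e0 uM fv w; rewrite L_adj (le_trans (fv _)) // -mulrA.
by rewrite ler_wpM2l.
Qed.

Fact ext_act_subproof u (f : H) :
  (fun w => f (L (star u) w)) \in completion_pred k.
Proof.
apply/asboolP => e e0; have [M M0 uM] := L_bounded (star u).
(* [M] may be 0, so the error is divided by [M + 1]. *)
have M1 : 0 < M + 1 by rewrite ltr_wpDl.
have [v fv] := cfun_approx f (divr_gt0 e0 M1); exists (L u v).
have eM : 0 <= e / (M + 1) by rewrite ltW ?divr_gt0.
apply: approxW (approx_act eM uM fv).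
by rewrite mulrAC ler_pdivrMr // ler_pM2l // lerDl.
Qed.

(** Forced by [<u f, w> = <f, star u w>]. On embedded vectors [L_adj] identifies it with [L u]. *)
Definition ext_act u (f : H) : H := Completion (ext_act_subproof u f).

Lemma ext_act_embed u v : ext_act u (cembed k v) = cembed k (L u v).
Proof. by apply: cfun_inj => w /=; rewrite L_adj. Qed.

Fact ext_act_linear u : linear (ext_act u).
Proof. by move=> c f g; apply: cfun_inj. Qed.

HB.instance Definition _ u := GRing.isLinear.Build C H H *:%R (ext_act u)
  (ext_act_linear u).

Lemma ext_act_bounded u : exists M : C, forall f : H, `|ext_act u f| <= M * `|f|.
Proof.
have [M M0 uM] := L_bounded u; have [M' M'0 uM'] := L_bounded (star u).
exists M => f; rewrite -subr_le0.
(* The order of [C] is partial: the failure of an inequality gives the opposite strict one only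
   between reals. *)
have re : `|ext_act u f| - M * `|f| \is Num.real by rewrite realB ?realM ?ger0_real.
rewrite real_leNgt ?real0 //; apply/negP => gap.
have M1 : 0 < M + M' + 1 by rewrite ltr_wpDl // addr_ge0.
(* Replacing [f] by an [e]-close embedded vector costs [e * (M' + M)], with [M'] from the functional
   side and [M] from the norm side; this [e] keeps the cost below the gap. *)
have e0 := divr_gt0 gap M1; set e := _ / _ in e0.
have [v fv] := cfun_approx f e0.
have fve := cnorm_approx (ltW e0) fv.
have H1 : `|ext_act u f| <= e * M' + M * n v.
  rewrite -(subrK (cembed k (L u v)) (ext_act u f)).
  rewrite (le_trans (ler_normD _ _)) // lerD //.
    apply: cnorm_approx; first by rewrite mulr_ge0 // ltW.
    exact: approx_act (ltW e0) uM' fv.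
  by rewrite cnormE cnorm_cembed.
have H2 : n v <= `|f| + e.
  rewrite -cnorm_cembed -cnormE -(subKr f (cembed k v)).
  by rewrite (le_trans (ler_normB _ _)) // lerD2l.
have : `|ext_act u f| - M * `|f| <= e * (M + M').
  rewrite lerBlDr (le_trans H1) //.
  rewrite (le_trans (lerD (lexx _) (ler_wpM2l M0 H2))) //.
  by rewrite le_eqVlt; apply/orP; left; apply/eqP; ring.
rewrite {1}/e mulrAC ler_pdivlMr // ler_pM2l // gerDl.
by rewrite ler10.
Qed.

Lemma ext_act_star u (f g : H) :
  cdot (ext_act u f) g = cdot f (ext_act (star u) g).
Proof.
have [M M0 uM] := L_bounded u.
have H1 := cdot_apx (ext_act u f) g.
apply: (fast_cvg_uniq H1); rewrite /=.
apply: (@cdotP _ _ k f (ext_act (star u) g) (fun m => L (star u) (apx g m)) M) => // m.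
rewrite mulrC; apply: approx_act (apxP g m); first exact: rate_ge0.
by move=> w; rewrite starK.
Qed.

(** Kept transparent so that the operators compute to [ext_act]. *)
Definition ext_rep : star_rep A (hilbert_completion k).
Proof.
refine (@StarRep R A (hilbert_completion k)
  (fun u => (ext_act u : {linear H -> H})) ext_act_bounded _ _ _ ext_act_star).
- move=> c u v f; apply: cfun_inj => w /=.
  by rewrite starD starZ L_lin cfun_antilinear conjCK.
- by move=> f; apply: cfun_inj => w /=; rewrite star1 L1.
- by move=> u v f; apply: cfun_inj => w /=; rewrite starM LM.
Defined.

Lemma ext_rep_embed u v : ext_rep u (cembed k v) = cembed k (L u v).
Proof. exact: ext_act_embed. Qed.

End ExtendAction.

(** * Universal property of the game algebra *)

Section FreeAction.
Variables (I : choiceType) (C : numClosedFieldType) (V : lmodType C).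
Variable T : I -> {linear V -> V}.
Local Notation F := (free_alg I C).
Implicit Types (f g : F) (v w : V) (m : fmonom I) (c : C).

Definition word_act m v : V := foldr (fun i => T i) v (m : seq I).

Definition free_act f v : V := \sum_(m <- msupp f) mcoeff m f *: word_act m v.

Lemma word_act_lin m c v w :
  word_act m (c *: v + w) = c *: word_act m v + word_act m w.
Proof.
by case: m => s; rewrite /word_act /=; elim: s => //= i s ->; rewrite linearP.
Qed.

Lemma word_actM m m' v : word_act (mmul m m') v = word_act m (word_act m' v).
Proof. by rewrite /word_act /mmul /= fmmulE /= foldr_cat. Qed.

Lemma free_actEw (d : {fset fmonom I}) f v : fsubset (msupp f) d ->
  free_act f v = \sum_(m <- d) mcoeff m f *: word_act m v.
Proof.
move=> le; rewrite /free_act (big_fset_incl _ le) //= => m _.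
by move=> /mcoeff_outdom ->; rewrite scale0r.
Qed.

Lemma free_act_linl c f g v :
  free_act (c *: f + g) v = c *: free_act f v + free_act g v.
Proof.
pose d := fsetU (msupp f) (fsetU (msupp g) (msupp (c *: f + g))).
rewrite !(@free_actEw d) ?fsubsetUl //; last 2 first.
- by rewrite /d fsetUCA fsubsetUl.
- by rewrite /d fsetUA fsubsetUr.
rewrite scaler_sumr -big_split /=; apply: eq_bigr => m _.
rewrite mcoeffD (mcoeffZ (R := C)) scalerDl scalerA.
by [].
Qed.

Lemma free_act_linr f c v w :
  free_act f (c *: v + w) = c *: free_act f v + free_act f w.
Proof.
rewrite /free_act scaler_sumr -big_split /=; apply: eq_bigr => m _.
by rewrite word_act_lin scalerDr !scalerA mulrC.
Qed.

Lemma free_act0l v : free_act 0 v = 0.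
Proof.
have := free_act_linl (-1) 0 0 v.
by rewrite scaler0 addr0 scaleN1r addNr.
Qed.

Lemma free_act0r f : free_act f 0 = 0.
Proof.
have := free_act_linr f (-1) 0 0.
by rewrite scaler0 addr0 scaleN1r addNr.
Qed.

Lemma free_actDl f g v : free_act (f + g) v = free_act f v + free_act g v.
Proof. by have := free_act_linl 1 f g v; rewrite !scale1r. Qed.

Lemma free_actBl f g v : free_act (f - g) v = free_act f v - free_act g v.
Proof.
by have := free_act_linl (-1) g f v; rewrite !scaleN1r ![- _ + _]addrC.
Qed.

Lemma free_act_suml (J : Type) (r : seq J) (f : J -> F) v :
  free_act (\sum_(j <- r) f j) v = \sum_(j <- r) free_act (f j) v.
Proof.
exact: (big_morph (free_act^~ v) (fun f g => free_actDl f g v) (free_act0l v)).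
Qed.

Lemma free_actU m c v : free_act (mkmalgU m c) v = c *: word_act m v.
Proof.
by rewrite (free_actEw _ msuppU_le) big_seq_fset1 mcoeffUU.
Qed.

Lemma free_act1 v : free_act 1 v = v.
Proof. by rewrite [LHS]free_actU scale1r /word_act fm1. Qed.

Lemma free_actM f g v : free_act (f * g) v = free_act f (free_act g v).
Proof.
rewrite malgME free_act_suml [RHS]/free_act; apply: eq_bigr => m _.
rewrite free_act_suml.
have -> : word_act m (free_act g v) =
    \sum_(m' <- msupp g) mcoeff m' g *: word_act m (word_act m' v).
  rewrite /free_act; elim/big_rec2: _ => [|m' x y _ <-].
    by have := word_act_lin m (-1) 0 0; rewrite scaler0 addr0 scaleN1r addNr.
  by rewrite word_act_lin.
rewrite scaler_sumr; apply: eq_bigr => m' _.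
by rewrite free_actU word_actM scalerA.
Qed.

Lemma free_act_gen i v : free_act (free_gen C i) v = T i v.
Proof. by rewrite [LHS]free_actU scale1r /word_act fmuE. Qed.

End FreeAction.

Section FreeInduction.
Variables (I : choiceType) (C : numClosedFieldType).
Local Notation F := (free_alg I C).

Lemma subalgebra0 (A : algType C) (S : set A) : subalgebra S -> S 0.
Proof.
by case=> S1 SD _; have := SD (-1) 1 1 S1 S1; rewrite scaleN1r addNr.
Qed.

Lemma free_alg_ind (S : set F) : subalgebra S ->
  (forall i, S (free_gen C i)) -> forall f, S f.
Proof.
move=> Ssub Sgen f; have S0 := subalgebra0 Ssub; case: Ssub => S1 SD SM.
have SU m : S (mkmalgU m 1).
  case: m; elim=> [|i s IHs].
    suff -> : mkmalgU (FMonom [::]) 1 = 1 :> F by exact: S1.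
    by congr mkmalgU; apply: val_inj; rewrite /= fm1.
  suff -> : mkmalgU (FMonom (i :: s)) 1 = free_gen C i * mkmalgU (FMonom s) 1 :> F.
    exact: SM.
  rewrite malgM_def /free_gen fgmulUU mulr1; congr mkmalgU.
  by apply: val_inj; rewrite /mmul /= fmmulE /= fmuE.
rewrite [f]monalgE; elim/big_rec: _ => // m x _ Sx.
suff -> : mkmalgU m (mcoeff m f) = mcoeff m f *: mkmalgU m 1 :> F by exact: SD.
apply/malgP => k; rewrite (mcoeffZ (R := C)) !mcoeffU.
by case: eqP; rewrite ?mulr1 ?mulr0.
Qed.

End FreeInduction.

Section GameAlgebraTheory.
Variables (R : realType) (G : game).
Local Notation C := R[i].
Local Notation U := (game_alg R G).
Local Notation proj := (quot_proj (game_star_ideal R G)).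

Lemma game_alg_ind (S : set U) : subalgebra S ->
  (forall x a, S (e1 R x a)) -> (forall y b, S (e2 R y b)) -> forall u, S u.
Proof.
move=> [S1 SD SM] Se1 Se2 u; rewrite -(quot_projK u); move: (repr u) => f.
pose S' : set (free_alg (game_gen G) C) := fun f => S (proj f).
apply: (@free_alg_ind _ _ S') => [|[[x a]|[y b]]]; last 2 first.
- exact: Se1.
- exact: Se2.
split=> [|c g h|g h] /=; rewrite /S'; first exact: S1.
  by rewrite quot_projD quot_projZ; exact: SD.
by rewrite quot_projM; exact: SM.
Qed.

Lemma proj_relation f : game_relation (@fe1 R G) (@fe2 R G) f -> proj f = 0.
Proof.
move=> Hf; have -> : 0 = proj 0 by apply: (addrI (proj 0)); rewrite -quot_projD !addr0.
by apply/quot_projP; rewrite subr0 => J [_]; apply.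
Qed.

Lemma projB f g : proj (f - g) = proj f - proj g.
Proof. by rewrite -[in LHS]scaleN1r quot_projD quot_projZ scaleN1r. Qed.

Lemma proj_sum (J : Type) (r : seq J) (P : pred J) (f : J -> free_alg (game_gen G) C) :
  proj (\sum_(j <- r | P j) f j) = \sum_(j <- r | P j) proj (f j).
Proof.
apply: (big_morph proj); first exact: quot_projD.
by apply: (addrI (proj 0)); rewrite -quot_projD !addr0.
Qed.

Lemma e1_e2C x a y b : e1 R x a * e2 R y b = e2 R y b * e1 R x a :> U.
Proof.
apply/eqP; rewrite -subr_eq0 -!quot_projM -projB; apply/eqP/proj_relation.
exact: rel_comm.
Qed.

Lemma e1_idem x a : e1 R x a * e1 R x a = e1 R x a :> U.
Proof.
apply/eqP; rewrite -subr_eq0 -!quot_projM -projB; apply/eqP/proj_relation.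
exact: rel_idem1.
Qed.

Lemma e2_idem y b : e2 R y b * e2 R y b = e2 R y b :> U.
Proof.
apply/eqP; rewrite -subr_eq0 -!quot_projM -projB; apply/eqP/proj_relation.
exact: rel_idem2.
Qed.

Lemma e1_orth x a a' : a != a' -> e1 R x a * e1 R x a' = 0 :> U.
Proof.
by move=> aa'; rewrite -quot_projM; apply/proj_relation; exact: rel_orth1.
Qed.

Lemma e2_orth y b b' : b != b' -> e2 R y b * e2 R y b' = 0 :> U.
Proof.
by move=> bb'; rewrite -quot_projM; apply/proj_relation; exact: rel_orth2.
Qed.

Lemma e1_sum x : \sum_a e1 R x a = 1 :> U.
Proof.
apply/eqP; rewrite -subr_eq0 -proj_sum -quot_proj1 -projB.
by apply/eqP/proj_relation; exact: rel_sum1.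
Qed.

Lemma e2_sum y : \sum_b e2 R y b = 1 :> U.
Proof.
apply/eqP; rewrite -subr_eq0 -proj_sum -quot_proj1 -projB.
by apply/eqP/proj_relation; exact: rel_sum2.
Qed.

(** The operators extend to the free algebra. The elements acting as 0 form an ideal that contains
    the relations, hence the whole game ideal, so the action of a class does not depend on its
    representative. *)
Lemma game_alg_action (V : lmodType C)
    (P : qX G -> aA G -> {linear V -> V}) (Q : qY G -> aB G -> {linear V -> V}) :
  (forall x a y b v, P x a (Q y b v) = Q y b (P x a v)) ->
  (forall x a v, P x a (P x a v) = P x a v) ->
  (forall y b v, Q y b (Q y b v) = Q y b v) ->
  (forall x a a' v, a != a' -> P x a (P x a' v) = 0) ->
  (forall y b b' v, b != b' -> Q y b (Q y b' v) = 0) ->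
  (forall x v, \sum_a P x a v = v) ->
  (forall y v, \sum_b Q y b v = v) ->
  exists L : U -> V -> V,
    [/\ forall c u v w, L (c *: u + v) w = c *: L u w + L v w,
        forall w, L 1 w = w,
        forall u v w, L (u * v) w = L u (L v w),
        forall x a w, L (e1 R x a) w = P x a w
      & forall y b w, L (e2 R y b) w = Q y b w].
Proof.
move=> PQ PP QQ PO QO PS QS.
pose T (g : game_gen G) : {linear V -> V} :=
  match g with inl (x, a) => P x a | inr (y, b) => Q y b end.
have actP x a v : free_act T (@fe1 R G x a) v = P x a v by exact: free_act_gen.
have actQ y b v : free_act T (@fe2 R G y b) v = Q y b v by exact: free_act_gen.
have act0 f : game_ideal (@fe1 R G) (@fe2 R G) f -> forall v, free_act T f v = 0.
  move=> /(_ [set g | forall v, free_act T g v = 0]%classic); apply.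
  split; first split=> [//||g h Hg Hh|g h _ Hh|g h _ Hh] v /=.
  - exact: free_act0l.
  - by rewrite free_actDl Hg Hh addr0.
  - by rewrite free_actM Hh free_act0r.
  - by rewrite free_actM Hh.
  move=> _ [x a y b|x a|y b|x a a' aa'|y b b' bb'|x|y] v /=.
  - rewrite free_actBl [X in X - _]free_actM [X in _ - X]free_actM.
    by rewrite actP actQ actQ actP PQ subrr.
  - by rewrite free_actBl expr2 free_actM !actP PP subrr.
  - by rewrite free_actBl expr2 free_actM !actQ QQ subrr.
  - by rewrite free_actM !actP PO.
  - by rewrite free_actM !actQ QO.
  - rewrite free_actBl free_act1 free_act_suml -[X in _ - X](PS x) -sumrB big1 //.
    by move=> a _; rewrite actP subrr.
  - rewrite free_actBl free_act1 free_act_suml -[X in _ - X](QS y) -sumrB big1 //.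
    by move=> b _; rewrite actQ subrr.
pose L (u : U) := free_act T (repr u).
have LE f v : L (proj f) v = free_act T f v.
  apply/eqP; rewrite -subr_eq0 -free_actBl; apply/eqP/act0.
  exact: (iffLR (quot_projP (game_star_ideal R G) _ _) (quot_projK (proj f))).
exists L; split.
- move=> c u v w; rewrite -(quot_projK u) -(quot_projK v) -quot_projZ -quot_projD.
  by rewrite !LE free_act_linl.
- by move=> w; rewrite -quot_proj1 LE free_act1.
- move=> u v w; rewrite -(quot_projK u) -(quot_projK v) -quot_projM.
  by rewrite !LE free_actM.
- by move=> x a w; rewrite LE actP.
- by move=> y b w; rewrite LE actQ.
Qed.

End GameAlgebraTheory.

(** * Separation from a convex cone *)

Section ConeSeparation.
Variables (R : realType) (V : lmodType R[i]).
Local Notation C := R[i].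
Implicit Types (K M : set V) (u v w : V) (r s : R).

Definition convex_cone K : Prop :=
  [/\ K 0, forall u v, K u -> K v -> K (u + v)
    & forall (c : C) u, 0 <= c -> K u -> K (c *: u)].

(* If neither [u] nor [- u] could be added to a maximal cone, combining the two
   expressions of [- e] would put [- e] in it. *)
Lemma maximal_cone K e : convex_cone K -> ~ K (- e) ->
  exists M, [/\ convex_cone M, (K `<=` M)%classic, ~ M (- e)
    & forall u, M u \/ M (- u)].
Proof.
move=> Kcone Ke.
(* Zorn's lemma is applied to the part added to [K], so that the empty chain, whose union is empty,
   still yields the cone [K]. *)
pose P : set (set V) := [set X | convex_cone (K `|` X) /\ ~ (K `|` X)%classic (- e)]%classic.
have chainP (F : set (set V)) : (F `<=` P)%classic -> total_on F subset ->
    P (\bigcup_(X in F) X)%classic.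
  move=> FP Ftot; have [K0 KD KZ] := Kcone.
  split; last by case=> // -[X FX Xe]; have [_] := FP X FX; apply; right.
  have KX u : (K `|` \bigcup_(X in F) X)%classic u -> K u \/ exists2 X, F X & X u.
    by case=> [|[X FX Xu]]; [left|right; exists X].
  have inX X u : F X -> (K `|` X)%classic u -> (K `|` \bigcup_(X in F) X)%classic u.
    by move=> FX [Ku|Xu]; [left|right; exists X].
  split; first by left.
  - move=> u v /KX[Ku|[X FX Xu]] /KX[Kv|[Y FY Yv]].
    + by left; exact: KD.
    + by apply: (inX Y) => //; have [[_ + _] _] := FP Y FY; apply; [left|right].
    + by apply: (inX X) => //; have [[_ + _] _] := FP X FX; apply; [right|left].
    + have [XY|YX] := Ftot X Y FX FY.
        apply: (inX Y) => //; have [[_ + _] _] := FP Y FY; apply; right => //.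
        exact: XY.
      apply: (inX X) => //; have [[_ + _] _] := FP X FX; apply; right => //.
      exact: YX.
  - move=> c u c0 /KX[Ku|[X FX Xu]]; first by left; exact: KZ.
    by apply: (inX X) => //; have [[_ _ +] _] := FP X FX; apply; [|right].
have [A [[Mcone Me] Amax]] := Zorn_bigcup chainP.
set M := (K `|` A)%classic in Mcone Me; exists M; split=> //.
  by move=> u; left.
have [M0 MD MZ] := Mcone.
(* Otherwise the cone [B] spanned by [M] and [u] would contradict maximality. *)
have ext u : ~ M u -> exists2 m, M m & exists2 c : C, 0 <= c & - e = m + c *: u.
  move=> Mu; apply: contrapT => Nex.
  pose B : set V := [set w | exists2 m, M m & exists2 c : C, 0 <= c & w = m + c *: u]%classic.
  have MB w : M w -> B w by move=> Mw; exists w => //; exists 0; rewrite ?scale0r ?addr0.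
  have Bu : B u by exists 0 => //; exists 1; rewrite ?scale1r ?add0r.
  have KB : (K `|` B = B)%classic.
    by apply/seteqP; split=> w; [case=> // Kw; apply: MB; left|right].
  apply: (Amax B).
    split; first by move=> w Aw; apply: MB; right.
    by move=> /(_ u Bu) Au; apply: Mu; right.
  rewrite /P /=; split; last by case.
  rewrite KB.
  split; first exact: MB.
    move=> _ _ [m Mm [c c0 ->]] [m' Mm' [c' c'0 ->]].
    exists (m + m'); first exact: MD.
    by exists (c + c'); rewrite ?addr_ge0 // scalerDl addrACA.
  move=> d _ d0 [m Mm [c c0 ->]]; exists (d *: m); first exact: MZ.
  by exists (d * c); rewrite ?mulr_ge0 // scalerDr scalerA.
move=> u; apply: contrapT => /not_orP[/ext[m Mm [c c0 E1]] /ext[m' Mm' [d d0 E2]]].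
apply: Me; have [c00|c_neq0] := eqVneq c 0.
  by rewrite E1 c00 scale0r addr0.
have cd : 0 < c + d by rewrite ltr_pwDl // lt0r c_neq0.
(* The multiples of [u] cancel: [c + d] times [- e] is [c *: m' + d *: m]. *)
rewrite -[- e](scalerK (_ : c + d != 0)) ?gt_eqF //; apply: (MZ).
  by rewrite invr_ge0 ltW.
rewrite scalerDl {1}E2 E1 !scalerDr !scalerN !scalerA [d * c]mulrC.
rewrite addrACA addNr addr0.
by apply: MD; exact: MZ.
Qed.

(** A maximal cone [M] contains [u] or [- u] for each [u], so membership of [u - r e] in [M] cuts
    the reals at a number [t u]; the order unit keeps it finite. [M] need not be closed, hence [ltt]
    and [gtt] ask for strict inequalities and additivity is proved up to [d]. Cone scalars are
    nonnegative reals, so [t] is only real-linear. *)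
Lemma cone_separation K e : convex_cone K -> ~ K (- e) ->
  (forall u, exists r, K (r%:C%C *: e - u)) ->
  exists t : V -> R,
    [/\ forall u v, t (u + v) = t u + t v,
        forall r u, t (r%:C%C *: u) = r * t u,
        forall u, K u -> 0 <= t u
      & t e = 1].
Proof.
move=> Kcone Ke unitK; have [M [[M0 MD MZ] KM Me Mtot]] := maximal_cone Kcone Ke.
have MZr r u : 0 <= r -> M u -> M (r%:C%C *: u) by move=> r0; apply: MZ; rewrite ler0c.
have Mee : M e by case: (Mtot e).
have Mr r : M (r%:C%C *: e) -> 0 <= r.
  move=> H; rewrite leNgt; apply/negP => r0; apply: Me.
  have -> : - e = (- r^-1)%:C%C *: (r%:C%C *: e).
    by rewrite scalerA -rmorphM mulNr mulVf ?lt_eqF // rmorphN1 scaleN1r.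
  by apply: MZr => //; rewrite oppr_ge0 invr_le0 ltW.
pose E u : set R := [set r | M (u - r%:C%C *: e)]%classic.
pose t u := sup (E u).
have bdE u r s : M (u - r%:C%C *: e) -> M (s%:C%C *: e - u) -> r <= s.
  move=> H1 H2; rewrite -subr_ge0; apply: Mr; have := MD _ _ H2 H1.
  by rewrite subrKA rmorphB scalerBl.
have supE u : has_sup (E u).
  split; last by have [s /KM Hs] := unitK u; exists s => r Er; exact: bdE Er Hs.
  have [s /KM] := unitK (- u); rewrite opprK addrC => Hs; exists (- s).
  by rewrite /E /= rmorphN scaleNr opprK.
have tge u r : M (u - r%:C%C *: e) -> r <= t u.
  by move=> H; apply: sup_upper_bound.
have tle u r : M (r%:C%C *: e - u) -> t u <= r.
  by move=> H; apply: ge_sup; [case: (supE u)|move=> s Es; exact: bdE Es H].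
have ltt u r : r < t u -> M (u - r%:C%C *: e).
  move=> /(sup_gt (supE u).1)[s Es rs].
  have -> : u - r%:C%C *: e = (u - s%:C%C *: e) + (s - r)%:C%C *: e.
    by rewrite rmorphB scalerBl subrKA.
  by apply: MD => //; apply: MZr => //; rewrite subr_ge0 ltW.
have gtt u r : t u < r -> M (r%:C%C *: e - u).
  move=> tr; have [/tge|] := Mtot (u - r%:C%C *: e).
    by rewrite leNgt tr.
  by rewrite opprB.
have tD u v : t (u + v) = t u + t v.
  apply/eqP; rewrite eq_le; apply/andP; split.
    apply/ler_addgt0Pr => d d0.
    have d2 : 0 < d / 2 by rewrite divr_gt0.
    have Hu := gtt u (t u + d / 2); have Hv := gtt v (t v + d / 2).
    have := MD _ _ (Hu _) (Hv _); rewrite !ltrDl => /(_ d2 d2) H.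
    apply: tle; have -> : t u + t v + d = t u + d / 2 + (t v + d / 2) by field.
    by rewrite rmorphD scalerDl opprD addrACA.
  apply/ler_addgt0Pr => d d0; rewrite -lerBlDr.
  have d2 : 0 < d / 2 by rewrite divr_gt0.
  have Hu := ltt u (t u - d / 2); have Hv := ltt v (t v - d / 2).
  have := MD _ _ (Hu _) (Hv _); rewrite !gtrBl => /(_ d2 d2) H.
  apply: tge; have -> : t u + t v - d = t u - d / 2 + (t v - d / 2) by field.
  by rewrite rmorphD scalerDl opprD addrACA.
have tZpos r u : 0 < r -> r * t u <= t (r%:C%C *: u).
  move=> r0; apply/ler_addgt0Pr => d d0; rewrite -lerBlDr; apply: tge.
  have -> : r * t u - d = r * (t u - d / r) by field; rewrite gt_eqF.
  rewrite rmorphM -scalerA -scalerBr; apply: MZr; first exact: ltW.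
  by apply: ltt; rewrite gtrBl divr_gt0.
have t0 : t 0 = 0 by apply: (addrI (t 0)); rewrite -tD !addr0.
have tN u : t (- u) = - t u by apply/eqP; rewrite -addr_eq0 -tD addNr t0.
have tZ r u : 0 < r -> t (r%:C%C *: u) = r * t u.
  move=> r0; apply/eqP; rewrite eq_le tZpos // andbT.
  have := tZpos r^-1 (r%:C%C *: u); rewrite invr_gt0 => /(_ r0).
  rewrite scalerA -rmorphM mulVf ?gt_eqF // rmorph1 scale1r.
  by rewrite mulrC ler_pdivrMr // mulrC.
exists t; split=> //.
- move=> r u; have [r0|r0|->] := ltgtP r 0; last by rewrite rmorph0 scale0r mul0r t0.
    by rewrite -[r]opprK rmorphN scaleNr tN tZ ?oppr_gt0 // -mulNr.
  exact: tZ.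
- by move=> u Ku; apply: tge; rewrite rmorph0 scale0r subr0; exact: KM.
- apply/eqP; rewrite eq_le; apply/andP; split.
    by apply: tle; rewrite rmorph1 scale1r subrr.
  by apply: tge; rewrite rmorph1 scale1r subrr.
Qed.

End ConeSeparation.

(** * Sums of squares and commutators *)

Section Subalgebras.
Variables (C : numClosedFieldType) (A : starAlgType C).
Implicit Types (S G : set A) (u v w : A) (c : C).

Lemma subalgebraD S u v : subalgebra S -> S u -> S v -> S (u + v).
Proof. by move=> [_ SD _] Su Sv; rewrite -[u]scale1r; exact: SD. Qed.

Lemma subalgebraZ S c u : subalgebra S -> S u -> S (c *: u).
Proof.
move=> Ssub Su; rewrite -[_ *: _]addr0; case: (Ssub) => _ SD _.
by apply: SD => //; exact: subalgebra0.
Qed.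

Lemma subalgebraN S u : subalgebra S -> S u -> S (- u).
Proof. by move=> Ssub Su; rewrite -scaleN1r; exact: subalgebraZ. Qed.

Lemma subalgebra_sum S (J : Type) (r : seq J) (P : pred J) (F : J -> A) :
  subalgebra S -> (forall j, P j -> S (F j)) -> S (\sum_(j <- r | P j) F j).
Proof.
move=> Ssub SF; elim/big_rec: _ => [|j u Pj Su]; first exact: subalgebra0.
by apply: subalgebraD => //; exact: SF.
Qed.

Lemma gen_subalgebraP G : subalgebra (gen_subalgebra G).
Proof.
split=> [S [[S1 _ _] _] //|c u v Gu Gv S HS|u v Gu Gv S HS];
  case: (HS) => -[_ SD SM] _.
- by apply: SD; [exact: Gu|exact: Gv].
- by apply: SM; [exact: Gu|exact: Gv].
Qed.

Lemma gen_subalgebra_gen G u : G u -> gen_subalgebra G u.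
Proof. by move=> Gu S [_]; apply. Qed.

Lemma gen_subalgebra_ind G S : subalgebra S -> (G `<=` S)%classic ->
  (gen_subalgebra G `<=` S)%classic.
Proof. by move=> Ssub GS u; apply. Qed.

Lemma gen_idealP S G : subalgebra S -> (G `<=` S)%classic ->
  ideal_of S (gen_ideal S G).
Proof.
move=> Ssub GS; have SS : ideal_of S S.
  case: (Ssub) => _ _ SM.
  by split=> // [|u v|]; [exact: subalgebra0|exact: subalgebraD|move=> s u Ss Su; exact: SM].
split=> [u /(_ S)|J [[_ ? _ _ _] _]//|u v Iu Iv J HJ|s u Ss Iu J HJ|s u Ss Iu J HJ];
  last 3 first; try (case: (HJ) => -[_ _ JD JMl JMr] _).
- by apply: JD; [exact: Iu|exact: Iv].
- by apply: JMl => //; exact: Iu.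
- by apply: JMr => //; exact: Iu.
by apply.
Qed.

Lemma gen_ideal_gen S G u : G u -> gen_ideal S G u.
Proof. by move=> Gu J [_]; apply. Qed.

Lemma gen_ideal_ind S G J : ideal_of S J -> (G `<=` J)%classic ->
  (gen_ideal S G `<=` J)%classic.
Proof. by move=> HJ GJ u; apply. Qed.

Lemma ideal_ofZ S J c u : subalgebra S -> ideal_of S J -> J u -> J (c *: u).
Proof.
move=> Ssub [_ _ _ JMl _] Ju; rewrite -mulr_algl.
by apply: JMl => //; apply: subalgebraZ => //; case: Ssub.
Qed.

(** Concatenation of two indexed families, which makes sums of squares and sums of commutators
    closed under addition. *)
Lemma sum_split_ord m n (F : 'I_m -> A) (F' : 'I_n -> A) :
  \sum_(i < m + n) match fintype.split i with inl j => F j | inr j => F' j end =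
  \sum_i F i + \sum_i F' i.
Proof.
rewrite big_split_ord; congr (_ + _); apply: eq_bigr => i _.
  by case: split_ordP => j; [move/lshift_inj->|move/eqP; rewrite eq_lrshift].
by case: split_ordP => j; [move/eqP; rewrite eq_rlshift|move/rshift_inj->].
Qed.

Section SumSets.
Variable S : set A.
Hypothesis Ssub : subalgebra S.
Hypothesis Sstar : forall u, S u -> S (star u).

Lemma commutator_sums0 : commutator_sums S 0.
Proof. by exists 0%N, (fun=> 0), (fun=> 0); split=> [[]//|]; rewrite big_ord0. Qed.

Lemma commutator_sums1 u v : S u -> S v -> commutator_sums S (u * v - v * u).
Proof. by move=> Su Sv; exists 1%N, (fun=> u), (fun=> v); rewrite big_ord1. Qed.

Lemma commutator_sumsD u v :
  commutator_sums S u -> commutator_sums S v -> commutator_sums S (u + v).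
Proof.
move=> [m [c [d [Scd ->]]]] [n [c' [d' [Scd' ->]]]].
exists (m + n)%N, (fun i => match fintype.split i with inl j => c j | inr j => c' j end),
  (fun i => match fintype.split i with inl j => d j | inr j => d' j end); split=> [i|].
  by case: fintype.split => j.
by rewrite -sum_split_ord; apply: eq_bigr => i _; case: fintype.split.
Qed.

Lemma commutator_sumsZ z u : commutator_sums S u -> commutator_sums S (z *: u).
Proof.
move=> [m [c [d [Scd ->]]]]; exists m, (fun i => z *: c i), d; split=> [i|].
  by case: (Scd i) => Sc Sd; split=> //; exact: subalgebraZ.
by rewrite scaler_sumr; apply: eq_bigr => i _; rewrite scalerBr scalerAl scalerAr.
Qed.

Lemma commutator_sums_star u : commutator_sums S u -> commutator_sums S (star u).
Proof.
move=> [m [c [d [Scd ->]]]].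
exists m, (fun i => star (d i)), (fun i => star (c i)); split=> [i|].
  by case: (Scd i) => Sc Sd; split; exact: Sstar.
by rewrite star_sum; apply: eq_bigr => i _; rewrite starD starN !starM.
Qed.

Lemma commutator_sums_sub u : commutator_sums S u -> S u.
Proof.
case: (Ssub) => _ _ SM [m [c [d [Scd ->]]]]; apply: subalgebra_sum => // i _.
case: (Scd i) => Sc Sd; apply: subalgebraD => //; first exact: SM.
by apply: subalgebraN => //; exact: SM.
Qed.

Lemma SOS0 : SOS S 0.
Proof. by exists 0%N, (fun=> 0); split=> [[]//|]; rewrite big_ord0. Qed.

Lemma SOS_square u : S u -> SOS S (star u * u).
Proof. by move=> Su; exists 1%N, (fun=> u); rewrite big_ord1. Qed.

Lemma SOS_D u v : SOS S u -> SOS S v -> SOS S (u + v).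
Proof.
move=> [m [c [Sc ->]]] [n [c' [Sc' ->]]].
exists (m + n)%N, (fun i => match fintype.split i with inl j => c j | inr j => c' j end).
split=> [i|]; first by case: fintype.split => j.
by rewrite -sum_split_ord; apply: eq_bigr => i _; case: fintype.split.
Qed.

Lemma SOS_Z z u : 0 <= z -> SOS S u -> SOS S (z *: u).
Proof.
move=> z0 [m [c [Sc ->]]]; exists m, (fun i => sqrtC z *: c i); split=> [i|].
  exact: subalgebraZ.
rewrite scaler_sumr; apply: eq_bigr => i _; rewrite starZ -scalerAl -scalerAr scalerA.
by rewrite geC0_conj ?sqrtC_ge0 // -expr2 sqrtCK.
Qed.

Lemma SOS_conj u v : S v -> SOS S u -> SOS S (star v * u * v).
Proof.
case: (Ssub) => _ _ SM Sv [m [c [Sc ->]]]; exists m, (fun i => c i * v).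
split=> [i|]; first exact: SM.
by rewrite mulr_sumr mulr_suml; apply: eq_bigr => i _; rewrite starM !mulrA.
Qed.

Lemma SOS_sub u : SOS S u -> S u.
Proof.
case: (Ssub) => _ _ SM [m [c [Sc ->]]]; apply: subalgebra_sum => // i _.
by apply: SM => //; exact: Sstar.
Qed.

Lemma SOS_SOS_tilde u : SOS S u -> SOS_tilde S u.
Proof.
move=> Hu; split; first exact: SOS_sub.
by exists u => //; rewrite subrr; exact: commutator_sums0.
Qed.

(** The algebraic form of a norm bound; it holds on a whole algebra once it holds on generators, and
    it makes [1] an order unit. *)
Definition bounded_elt u := exists2 M : C, 0 <= M & SOS S (M%:A - star u * u).

Lemma bounded_proj u : S u -> star u = u -> u * u = u -> bounded_elt u.
Proof.
move=> Su su uu; exists 1 => //; rewrite scale1r su uu.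
have -> : 1 - u = star (1 - u) * (1 - u).
  by rewrite starD starN star1 su mulrBl mul1r mulrBr mulr1 uu subrr subr0.
apply: SOS_square; apply: subalgebraD => //; first by case: Ssub.
exact: subalgebraN.
Qed.

Lemma bounded_scalar c : bounded_elt c%:A.
Proof.
exists (`|c| ^+ 2); first by rewrite exprn_ge0.
rewrite starZ star1 -scalerAl mul1r scalerA normCKC subrr.
exact: SOS0.
Qed.

Lemma boundedM u v : S v -> bounded_elt u -> bounded_elt v -> bounded_elt (u * v).
Proof.
move=> Sv [M M0 Hu] [N N0 Hv]; exists (M * N); first exact: mulr_ge0.
have -> : (M * N)%:A - star (u * v) * (u * v) =
    star v * (M%:A - star u * u) * v + M *: (N%:A - star v * v).
  rewrite [star v * _]mulrBr [X in _ = X + _]mulrBl mulr_algr -scalerAl.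
  rewrite [in RHS]scalerBr scalerA starM !mulrA.
  by rewrite [RHS]addrC addrA subrK.
by apply: SOS_D; [exact: SOS_conj|exact: SOS_Z].
Qed.

(** By the parallelogram identity, [2 u^*u + 2 v^*v] exceeds the square of [u + v] by the square of
    [u - v]. *)
Lemma boundedD u v : S u -> S v ->
  bounded_elt u -> bounded_elt v -> bounded_elt (u + v).
Proof.
move=> Su Sv [M M0 Hu] [N N0 Hv]; exists (2 * M + 2 * N).
  by rewrite addr_ge0 // mulr_ge0.
have -> : (2 * M + 2 * N)%:A - star (u + v) * (u + v) =
    (2 *: (M%:A - star u * u) + 2 *: (N%:A - star v * v)) + star (u - v) * (u - v).
  have E : star (u + v) * (u + v) + star (u - v) * (u - v) =
      2 *: (star u * u) + 2 *: (star v * v).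
    rewrite !starD starN !mulrDl !mulrDr !mulNr !mulrN opprK !scaler_nat !mulr2n.
    rewrite addrACA [X in X + _]addrACA [X in _ + X]addrACA.
    by rewrite !subrr addr0 add0r.
  rewrite !scalerBr !scalerA scalerDl [X in _ = X + _]addrACA.
  by rewrite -opprD -E opprD -[RHS]addrA addrNK.
apply: SOS_D; last first.
  by apply: SOS_square; apply: subalgebraD => //; exact: subalgebraN.
by apply: SOS_D; apply: SOS_Z.
Qed.

Lemma bounded_order_unit u : S u -> bounded_elt u ->
  exists2 M : C, 0 <= M & SOS S (M%:A - (u + star u)).
Proof.
move=> Su [M M0 Hu]; exists (1 + M); first by rewrite addr_ge0.
have -> : (1 + M)%:A - (u + star u) = star (1 - u) * (1 - u) + (M%:A - star u * u).
  rewrite starD starN star1 mulrBl mul1r mulrBr mulr1 scalerDl scale1r opprB.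
  by rewrite -[RHS]addrA [X in _ = _ + X]addrC subrKA addrACA opprD.
apply: SOS_D => //; apply: SOS_square; apply: subalgebraD => //.
  by case: Ssub.
exact: subalgebraN.
Qed.

End SumSets.
End Subalgebras.

(** * One side of a mirror game *)

Definition pvm (C : numClosedFieldType) (U : starAlgType C) (A : finType) (p : A -> U) : Prop :=
  [/\ forall a, star (p a) = p a,
      forall a, p a * p a = p a,
      forall a a', a != a' -> p a * p a' = 0
    & \sum_a p a = 1].

Lemma pvm_sub_sum (C : numClosedFieldType) (U : starAlgType C) (A : finType)
    (p : A -> U) (P : pred A) :
  pvm p -> 1 - \sum_(a | P a) p a = \sum_(a | ~~ P a) p a.
Proof. by case=> _ _ _ <-; rewrite (bigID P) /= addrAC subrr add0r. Qed.

Lemma pvm_sumM (C : numClosedFieldType) (U : starAlgType C) (A : finType)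
    (p : A -> U) (P Q : pred A) : pvm p ->
  (\sum_(a | P a) p a) * (\sum_(a | Q a) p a) = \sum_(a | P a && Q a) p a.
Proof.
case=> _ pp po _; rewrite mulr_suml big_mkcondr; apply: eq_bigr => a Pa.
rewrite mulr_sumr; case: ifP => Qa.
  by rewrite (bigD1 a) //= pp big1 ?addr0 // => a' /andP[_ /negPf aa']; rewrite po // eq_sym aa'.
by rewrite big1 // => a' Qa'; rewrite po //; apply: contraTneq Qa' => <-; rewrite Qa.
Qed.

Section LeftRightMultiplication.
Variables (C : numClosedFieldType) (A : algType C).

Definition lmul (u v : A) := u * v.
Definition rmul (u v : A) := v * u.

Fact lmul_linear u : linear (lmul u).
Proof. by move=> c v w; rewrite /lmul mulrDr scalerAr. Qed.
Fact rmul_linear u : linear (rmul u).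
Proof. by move=> c v w; rewrite /rmul mulrDl scalerAl. Qed.

HB.instance Definition _ u := GRing.isLinear.Build C A A *:%R (lmul u)
  (lmul_linear u).
HB.instance Definition _ u := GRing.isLinear.Build C A A *:%R (rmul u)
  (rmul_linear u).

End LeftRightMultiplication.

(** The actions are purely linear, without adjoints or norms, so the property serves both for the
    retraction onto one side and for the GNS action. *)
Definition universal_pvm_pair (C : numClosedFieldType) (U : starAlgType C)
    (X Y A B : finType) (p : X -> A -> U) (q : Y -> B -> U) : Prop :=
  forall (V : lmodType C)
    (P : X -> A -> {linear V -> V}) (Q : Y -> B -> {linear V -> V}),
  (forall x a y b v, P x a (Q y b v) = Q y b (P x a v)) ->
  (forall x a v, P x a (P x a v) = P x a v) ->
  (forall y b v, Q y b (Q y b v) = Q y b v) ->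
  (forall x a a' v, a != a' -> P x a (P x a' v) = 0) ->
  (forall y b b' v, b != b' -> Q y b (Q y b' v) = 0) ->
  (forall x v, \sum_a P x a v = v) ->
  (forall y v, \sum_b Q y b v = v) ->
  exists L : U -> V -> V,
    [/\ forall c u v w, L (c *: u + v) w = c *: L u w + L v w,
        forall w, L 1 w = w,
        forall u v w, L (u * v) w = L u (L v w),
        forall x a w, L (p x a) w = P x a w
      & forall y b w, L (q y b) w = Q y b w].

Section HalfGame.
Variables (R : realType) (U : starAlgType R[i]) (X Y A B : finType).
Local Notation C := R[i].
Variables (lam : X -> Y -> A -> B -> bool) (p : X -> A -> U) (q : Y -> B -> U).
Variables (xi : X -> Y) (eta : Y -> X).
Hypothesis p_pvm : forall x, pvm (p x).
Hypothesis q_pvm : forall y, pvm (q y).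
Hypothesis pqC : forall x a y b, p x a * q y b = q y b * p x a.
Hypothesis mirror1 : forall x a a' b, a != a' ->
  ~~ (lam x (xi x) a b && lam x (xi x) a' b).
Hypothesis mirror2 : forall y a b b', b != b' ->
  ~~ (lam (eta y) y a b && lam (eta y) y a b').

Definition side_alg : set U := gen_subalgebra [set u | exists x a, u = p x a]%classic.
Definition mirror_sum y b : U := \sum_(a | lam (eta y) y a b) p (eta y) a.
Definition mirror_ideal : set U := gen_ideal side_alg [set u | exists x y a b,
  ~~ lam x y a b /\ u = p x a * mirror_sum y b]%classic.

(** The expectation condition in a pointwise form that is symmetric in the players;
    [perfect_expectation] relates the two. *)
Definition perfect_vector (H : hilbert R) (pi : star_rep U H) (psi : H) : Prop :=
  `|psi| = 1 /\ forall x y a b, ~~ lam x y a b -> pi (p x a * q y b) psi = 0.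

Local Notation S := side_alg.
Local Notation J := mirror_ideal.
Local Notation f := mirror_sum.

Let pstar x a : star (p x a) = p x a. Proof. by case: (p_pvm x). Qed.
Let qstar y b : star (q y b) = q y b. Proof. by case: (q_pvm y). Qed.
Let pp x a : p x a * p x a = p x a. Proof. by case: (p_pvm x). Qed.
Let qq y b : q y b * q y b = q y b. Proof. by case: (q_pvm y). Qed.
Let psum x : \sum_a p x a = 1. Proof. by case: (p_pvm x). Qed.

Let Ssub : subalgebra S. Proof. exact: gen_subalgebraP. Qed.
Let Sp x a : S (p x a). Proof. by apply: gen_subalgebra_gen; exists x, a. Qed.
Let SM u v : S u -> S v -> S (u * v). Proof. by case: Ssub => _ _; apply. Qed.
Let S1 : S 1. Proof. by case: Ssub. Qed.

Lemma side_alg_star u : S u -> S (star u).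
Proof.
move=> Su; apply: (@gen_subalgebra_ind _ _ _ [set u | S (star u)]%classic _ _ _ Su).
  split=> [|c v w Sv Sw|v w Sv Sw] /=.
  - by rewrite star1.
  - by rewrite starD starZ; case: Ssub => _ + _; apply.
  - by rewrite starM; exact: SM.
by move=> _ [x [a ->]] /=; rewrite pstar.
Qed.

Lemma mirror_sum_side y b : S (f y b).
Proof. exact: subalgebra_sum. Qed.

Lemma mirror_sum_star y b : star (f y b) = f y b.
Proof. by rewrite star_sum; apply: eq_bigr. Qed.

Lemma mirror_idealP : ideal_of S J.
Proof.
apply: gen_idealP => // _ [x [y [a [b [_ ->]]]]].
by apply: SM => //; exact: mirror_sum_side.
Qed.

(** * From a perfect vector to a tracial state on one side *)

Section Necessity.
Variables (H : hilbert R) (pi : star_rep U H) (psi : H).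
Hypothesis perfect : perfect_vector pi psi.

Let phi u : C := inner H (pi u psi) psi.

Let rep_lin c u v w : pi (c *: u + v) w = c *: pi u w + pi v w.
Proof. exact: rep_linear. Qed.
Let rep0 w : pi 0 w = 0.
Proof. by have := rep_lin (-1) 0 0 w; rewrite scaler0 addr0 scaleN1r addNr. Qed.
Let repD u v w : pi (u + v) w = pi u w + pi v w.
Proof. by have := rep_lin 1 u v w; rewrite !scale1r. Qed.
Let repN u w : pi (- u) w = - pi u w.
Proof. by have := rep_lin (-1) u 0 w; rewrite rep0 !addr0 !scaleN1r. Qed.

Let phi_lin c u v : phi (c *: u + v) = c * phi u + phi v.
Proof. by rewrite /phi rep_lin linearPl. Qed.
Let phi0 : phi 0 = 0. Proof. by rewrite /phi rep0 linear0l. Qed.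
Let phiD u v : phi (u + v) = phi u + phi v.
Proof. by have := phi_lin 1 u v; rewrite scale1r mul1r. Qed.
Let phiN u : phi (- u) = - phi u.
Proof. by have := phi_lin (-1) u 0; rewrite phi0 !addr0 scaleN1r mulN1r. Qed.
Let phi_sum (K : finType) (F : K -> U) : phi (\sum_i F i) = \sum_i phi (F i).
Proof. exact: (big_morph _ phiD phi0). Qed.
Let phi_sum_ord n (F : 'I_n -> U) : phi (\sum_i F i) = \sum_i phi (F i).
Proof. exact: (big_morph _ phiD phi0). Qed.
Let phi1 : phi 1 = 1.
Proof. by rewrite /phi rep1 -inner_norm; case: perfect => -> _; rewrite expr1n. Qed.
Let phi_star u : phi (star u) = (phi u)^*.
Proof. by rewrite /phi rep_star starK hermC /= expr0 mul1r. Qed.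
Let phi_ge0 u : 0 <= phi (star u * u).
Proof. by rewrite /phi repM rep_star starK -inner_norm exprn_ge0. Qed.

Let kills w := pi w psi = 0.
Let killsD u v : kills u -> kills v -> kills (u + v).
Proof. by rewrite /kills repD => -> ->; rewrite addr0. Qed.
Let killsN u : kills u -> kills (- u).
Proof. by rewrite /kills repN => ->; rewrite oppr0. Qed.
Let killsM u v : kills v -> kills (u * v).
Proof. by rewrite /kills repM => ->; rewrite linear0. Qed.
Let kills_sum (K : finType) (P : pred K) (F : K -> U) :
  (forall i, P i -> kills (F i)) -> kills (\sum_(i | P i) F i).
Proof. by move=> H0; elim/big_ind: _ => //; exact: rep0. Qed.
Let kills_pq x y a b : ~~ lam x y a b -> kills (p x a * q y b).
Proof. by case: perfect => _; apply. Qed.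
Let phi_killsr u w : kills w -> phi (u * w) = 0.
Proof. by rewrite /kills /phi repM => ->; rewrite linear0 linear0l. Qed.
Let phi_killsl u w : kills w -> phi (star w * u) = 0.
Proof. by move=> w0; rewrite -[u]starK -starM phi_star phi_killsr // rmorph0. Qed.

Let g x a : U := \sum_(b | lam x (xi x) a b) q (xi x) b.

(** The difference is [p (1 - g) - (1 - p) g]. The first product sums losing pairs by the definition
    of [g]; the second pairs a [b] winning with [a] with some other answer [a'], which loses by the
    mirror condition. *)
Let kills_pg x a : kills (p x a - g x a).
Proof.
have -> : p x a - g x a = p x a * (1 - g x a) - (1 - p x a) * g x a.
  by rewrite mulrBr mulrBl mulr1 mul1r opprB addrA addrNK.
apply: killsD; last apply: killsN.
  rewrite (pvm_sub_sum _ (q_pvm _)) mulr_sumr; apply: kills_sum => b lb.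
  exact: kills_pq.
rewrite -(big_pred1_eq +%R a (p x)) (pvm_sub_sum _ (p_pvm _)) mulr_suml.
apply: kills_sum => a' aa'; rewrite mulr_sumr; apply: kills_sum => b lb.
apply: kills_pq; have := mirror1 x b aa'; rewrite lb andbT.
by [].
Qed.

Let kills_qf y b : kills (q y b - f y b).
Proof.
have fq : f y b * q y b = q y b * f y b.
  by rewrite mulr_suml mulr_sumr; apply: eq_bigr => a _; exact: pqC.
have -> : q y b - f y b = (1 - f y b) * q y b - f y b * (1 - q y b).
  by rewrite mulrBr mulrBl mulr1 mul1r opprB addrA addrNK.
apply: killsD; last apply: killsN.
  rewrite (pvm_sub_sum _ (p_pvm _)) mulr_suml; apply: kills_sum => a la.
  exact: kills_pq.
rewrite -(big_pred1_eq +%R b (q y)) (pvm_sub_sum _ (q_pvm _)) mulr_suml.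
apply: kills_sum => a la; rewrite mulr_sumr; apply: kills_sum => b' bb'.
by apply: kills_pq; have := mirror2 y a bb'; rewrite la andbT.
Qed.

(** For a generator, [phi (s p) = phi (s g) = phi (g s) = phi (p s)]: [p] and [g] agree on [psi], on
    the right directly and on the left by taking adjoints, and [g] commutes with [S]. *)
Let phi_tracial u v : S u -> S v -> phi (u * v) = phi (v * u).
Proof.
move=> Su Sv; suff: (S `<=` [set v | S v /\ forall u, S u -> phi (u * v) = phi (v * u)])%classic.
  by move=> /(_ v Sv)[_]; apply.
apply: gen_subalgebra_ind => [|_ [x [a ->]]].
  split=> [|c w z [Sw Hw] [Sz Hz]|w z [Sw Hw] [Sz Hz]].
  - by split=> [//|s Ss]; rewrite mulr1 mul1r.
  - split=> [|s Ss]; first by case: Ssub => _ + _; apply.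
    by rewrite mulrDr mulrDl -scalerAr -scalerAl !phi_lin Hw // Hz.
  - split=> [|s Ss]; first exact: SM.
    by rewrite mulrA (Hz _ (SM Ss Sw)) mulrA (Hw _ (SM Sz Ss)) mulrA.
split=> // s Ss.
have gs : g x a * s = s * g x a.
  apply: (@gen_subalgebra_ind _ _ _ [set s | g x a * s = s * g x a]%classic _ _ _ Ss).
    split=> [|c w z /= Hw Hz|w z /= Hw Hz] /=.
    - by rewrite mulr1 mul1r.
    - by rewrite mulrDr mulrDl -scalerAr -scalerAl Hw Hz.
    - by rewrite mulrA Hw -mulrA Hz mulrA.
  move=> _ [x' [a' ->]] /=; rewrite mulr_suml mulr_sumr.
  by apply: eq_bigr => b _; rewrite pqC.
have gstar : star (g x a) = g x a by rewrite star_sum; apply: eq_bigr.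
have -> : s * p x a = s * (p x a - g x a) + s * g x a by rewrite mulrBr addrNK.
have -> : p x a * s = star (p x a - g x a) * s + g x a * s.
  by rewrite starD starN pstar gstar mulrBl addrNK.
by rewrite !phiD phi_killsr // phi_killsl // gs.
Qed.

Let phi_ideal u : J u -> phi u = 0.
Proof.
(* Vanishing of [phi] alone is not an ideal condition; with the factor [w] it is stable under left
   multiplication, and traciality adds the right one. *)
move=> Ju; suff: (J `<=` [set v | S v /\ forall w, S w -> phi (w * v) = 0])%classic.
  by move=> /(_ u Ju)[_ /(_ 1 S1)]; rewrite mul1r.
apply: gen_ideal_ind.
  split=> [v []//||v w [Sv Hv] [Sw Hw]|s v Ss [Sv Hv]|s v Ss [Sv Hv]].
  - by split=> [|w _]; [exact: subalgebra0 Ssub|rewrite mulr0 phi0].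
  - split=> [|z Sz]; first exact: (subalgebraD Ssub Sv Sw).
    by rewrite mulrDr phiD Hv // Hw // addr0.
  - by split=> [|z Sz]; [exact: SM|rewrite mulrA (Hv _ (SM Sz Ss))].
  - split=> [|z Sz]; first exact: SM.
    by rewrite mulrA (phi_tracial (SM Sz Sv) Ss) mulrA (Hv _ (SM Ss Sz)).
move=> _ [x [y [a [b [lb ->]]]]]; split=> [|w Sw].
  by apply: SM => //; exact: mirror_sum_side.
apply: phi_killsr.
have -> : p x a * f y b = p x a * q y b - p x a * (q y b - f y b).
  by rewrite mulrBr subKr.
by apply: killsD; [exact: kills_pq lb|exact: (killsN (killsM _ (kills_qf y b)))].
Qed.

Lemma perfect_vector_sound :
  ~ set_add (set_add (SOS_tilde S) J) (star_set J) (-1).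
Proof.
move=> [_ [s [Ss [b [m [c [Sc bE]]]] [n [d [d' [Sd sbE]]]]] [j Jj <-]] [_ [j' Jj' <-]]].
move=> /(congr1 phi); rewrite !phiD phi_star (phi_ideal Jj) (phi_ideal Jj') conjC0 !addr0.
rewrite phiN phi1 -[s](subrK b) sbE phiD phi_sum_ord big1 => [|i _]; last first.
  by case: (Sd i) => ? ?; rewrite phiD phiN phi_tracial ?subrr.
rewrite add0r bE phi_sum_ord => E.
have : 0 <= \sum_i phi (star (c i) * c i) by apply: sumr_ge0.
by rewrite E oppr_ge0 ler10.
Qed.

End Necessity.

(** * From the cone condition to a perfect vector *)

Section Sufficiency.
Hypothesis regular2 : forall y a, exists b, lam (eta y) y a b.
Hypothesis U_ind : forall T : set U, subalgebra T ->
  (forall x a, T (p x a)) -> (forall y b, T (q y b)) -> forall u, T u.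
Hypothesis U_univ : universal_pvm_pair p q.
Variable b0 : B.

Lemma mirror_sum_pvm y : pvm (f y).
Proof.
split=> [b|b|b b' bb'|].
- exact: mirror_sum_star.
- by rewrite (pvm_sumM _ _ (p_pvm _)); apply: eq_bigl => a; rewrite andbb.
- rewrite (pvm_sumM _ _ (p_pvm _)) big1 // => a lab.
  by have := mirror2 y a bb'; rewrite lab.
(* Each [a] wins with exactly one [b]: at least one by regularity, at most one by the mirror
   condition. *)
- rewrite -(psum (eta y)) /mirror_sum.
  rewrite (exchange_big_dep predT) //=; apply: eq_bigr => a _.
  have [b lb] := regular2 y a; rewrite (bigD1 b) //= big1 ?addr0 // => b' /andP[lb' bb'].
  by have := mirror2 y a bb'; rewrite lb lb'.
Qed.

(* Sending the generators of the other side to scalars. *)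
Lemma side_retraction : exists r : U -> U,
  [/\ forall c u v, r (c *: u + v) = c *: r u + r v,
      forall u v, r (u * v) = r u * r v,
      forall u, r (star u) = star (r u),
      forall u, S (r u)
    & forall u, S u -> r u = u].
Proof.
(* The other player deterministically answers [b0]. *)
pose d b : C := (b == b0)%:R.
have dd b : d b * d b = d b by rewrite /d; case: eqP; rewrite ?mulr1 ?mulr0.
have dsum : \sum_b d b = 1.
  by rewrite (bigD1 b0) //= /d eqxx big1 ?addr0 // => b /negPf->.
have dstar b : (d b)^* = d b by rewrite /d; case: eqP; rewrite ?conjC1 ?conjC0.
have [||||||| L [L_lin L1 LM Lp Lq]] := @U_univ U
  (fun x a => (lmul (p x a) : {linear U -> U}))
  (fun y b => (lmul ((d b)%:A) : {linear U -> U})).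
- by move=> x a y b v /=; rewrite /lmul !mulr_algl scalerAr.
- by move=> x a v /=; rewrite /lmul mulrA pp.
- by move=> y b v /=; rewrite /lmul !mulr_algl scalerA dd.
- by move=> x a a' v aa' /=; rewrite /lmul mulrA; case: (p_pvm x) => _ _ -> //; rewrite mul0r.
- move=> y b b' v bb' /=; rewrite /lmul !mulr_algl scalerA.
  suff -> : d b * d b' = 0 by rewrite scale0r.
  rewrite /d; case: eqP => [bb0|]; last by rewrite mul0r.
  by rewrite -bb0 eq_sym (negPf bb') mulr0.
- by move=> x v /=; rewrite /lmul -mulr_suml psum mul1r.
- move=> y v /=; rewrite /lmul; under eq_bigr do rewrite mulr_algl.
  by rewrite -scaler_suml dsum scale1r.
(* All generators act by left multiplications, so [L u] is left multiplication by [L u 1]; this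
   makes [u |-> L u 1] multiplicative. *)
have Lr u v w : L u (v * w) = L u v * w.
  move: u v w; apply: (U_ind (T := fun u => forall v w, L u (v * w) = L u v * w)).
  - split=> [v w|c u u' Hu Hu' v w|u u' Hu Hu' v w].
    + by rewrite !L1.
    + by rewrite !L_lin Hu Hu' mulrDl scalerAl.
    + by rewrite !LM Hu' Hu.
  - by move=> x a v w; rewrite !Lp /= /lmul mulrA.
  - by move=> y b v w; rewrite !Lq /= /lmul mulrA.
pose r u := L u 1.
have r_lin c u v : r (c *: u + v) = c *: r u + r v by exact: L_lin.
have rM u v : r (u * v) = r u * r v by rewrite /r LM -[X in L u X]mul1r Lr.
have r1 : r 1 = 1 by rewrite /r L1.
have rp x a : r (p x a) = p x a by rewrite /r Lp /= /lmul mulr1.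
have rq y b : r (q y b) = (d b)%:A by rewrite /r Lq /= /lmul mulr1.
exists r; split=> //.
- apply: (U_ind (T := fun u => r (star u) = star (r u))).
  + split=> [|c u v Hu Hv|u v Hu Hv].
    * by rewrite star1 r1 star1.
    * by rewrite starD starZ !r_lin Hu Hv starD starZ.
    * by rewrite starM !rM Hu Hv starM.
  + by move=> x a; rewrite pstar rp pstar.
  + by move=> y b; rewrite qstar rq starZ star1 dstar.
- apply: (U_ind (T := fun u => S (r u))).
  + split=> [|c u v Hu Hv|u v Hu Hv].
    * by rewrite r1.
    * by rewrite r_lin; case: Ssub => _ + _; apply.
    * by rewrite rM; exact: SM.
  + by move=> x a; rewrite rp.
  + by move=> y b; rewrite rq; exact: (subalgebraZ _ Ssub S1).
- move=> u Su; apply: (@gen_subalgebra_ind _ _ _ [set u | r u = u]%classic _ _ _ Su).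
    split=> [|c v w /= Hv Hw|v w /= Hv Hw] /=; first exact: r1.
      by rewrite r_lin Hv Hw.
    by rewrite rM Hv Hw.
  by move=> _ [x [a ->]] /=.
Qed.

(** What a tracial state killing [J] must kill. Taking both [J] and its star makes it a star-stable
    complex subspace. *)
Let N : set U := fun n => exists c j j',
  [/\ commutator_sums S c, J j, J j' & n = c + j + star j'].

Let JD u v : J u -> J v -> J (u + v).
Proof. by case: mirror_idealP => _ _ + _ _; apply. Qed.
Let JZ c u : J u -> J (c *: u).
Proof. exact: ideal_ofZ Ssub mirror_idealP. Qed.
Let J0 : J 0. Proof. by case: mirror_idealP. Qed.
Let JS u : J u -> S u. Proof. by case: mirror_idealP => + _ _ _ _; apply. Qed.

Let ND u v : N u -> N v -> N (u + v).
Proof.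
move=> [c [j [j' [Hc Hj Hj' ->]]]] [d [k [k' [Hd Hk Hk' ->]]]].
exists (c + d), (j + k), (j' + k'); split; [|exact: JD|exact: JD|].
  exact: commutator_sumsD.
by rewrite starD [LHS]addrACA [X in X + _]addrACA.
Qed.

Let NZ z u : N u -> N (z *: u).
Proof.
move=> [c [j [j' [Hc Hj Hj' ->]]]].
exists (z *: c), (z *: j), (z^* *: j'); split; [|exact: JZ|exact: JZ|].
  exact: (commutator_sumsZ Ssub).
by rewrite starZ conjCK !scalerDr.
Qed.

Let N_star u : N u -> N (star u).
Proof.
move=> [c [j [j' [Hc Hj Hj' ->]]]]; exists (star c), j', j; split=> //.
  exact: (commutator_sums_star side_alg_star Hc).
by rewrite !starD starK addrAC.
Qed.

Let N_comm u : commutator_sums S u -> N u.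
Proof. by exists u, 0, 0; rewrite star0 !addr0. Qed.

Let N_ideal u : J u -> N u.
Proof.
by exists 0, u, 0; split=> //; rewrite ?star0 ?addr0 ?add0r //; exact: commutator_sums0.
Qed.

Let S_bounded u : S u -> bounded_elt S u.
Proof.
move=> Su; suff : S u /\ bounded_elt S u by case.
apply: (@gen_subalgebra_ind _ _ _ [set u | S u /\ bounded_elt S u]%classic _ _ _ Su).
  split=> [|c v w [Sv Hv] [Sw Hw]|v w [Sv Hv] [Sw Hw]].
  - by split=> //; rewrite -(scale1r 1); exact: bounded_scalar.
  - have Scv : S (c *: v) by exact: (subalgebraZ _ Ssub).
    split; first exact: (subalgebraD Ssub).
    apply: (boundedD Ssub) => //; rewrite -mulr_algl.
    by apply: (boundedM Ssub) => //; exact: bounded_scalar.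
  - by split; [exact: SM|exact: (boundedM Ssub)].
move=> _ [x [a ->]]; split=> //.
exact: (bounded_proj Ssub).
Qed.

(** The functional factors through the retraction [r], which sends commutators of [U] to commutators
    of [S]; hence traciality on all of [U]. *)
Lemma tracial_state :
  ~ set_add (set_add (SOS_tilde S) J) (star_set J) (-1) ->
  exists tau : U -> C,
    [/\ forall c u v, tau (c *: u + v) = c * tau u + tau v,
        forall u, tau (star u) = (tau u)^*,
        forall u, 0 <= tau (star u * u),
        tau 1 = 1
      & (forall u v, tau (u * v) = tau (v * u)) /\ forall u, J u -> tau u = 0].
Proof.
move=> HN1; have [r [r_lin rM r_star rS rid]] := side_retraction.
have r0 : r 0 = 0 by rewrite rid //; exact: (subalgebra0 Ssub).
have r1 : r 1 = 1 by rewrite rid.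
have rD u v : r (u + v) = r u + r v by have := r_lin 1 u v; rewrite !scale1r.
have rZ c u : r (c *: u) = c *: r u.
  by have := r_lin c u 0; rewrite r0 !addr0.
have rN u : r (- u) = - r u by rewrite -scaleN1r rZ scaleN1r.
have N0 : N 0 by exact: N_ideal.
(* Twice the real part of [r u] is tested, which explains the halves below. *)
pose K : set U := fun u => exists s n, [/\ SOS S s, N n & r u + star (r u) = s + n].
have Kcone : convex_cone K.
  split.
  - by exists 0, 0; split=> //; [exact: SOS0|rewrite r0 star0].
  - move=> u v [s [n [Hs Hn E]]] [s' [n' [Hs' Hn' E']]].
    exists (s + s'), (n + n'); split; [exact: SOS_D|exact: ND|].
    by rewrite rD starD addrACA E E' addrACA.
  - move=> c u c0 [s [n [Hs Hn E]]]; exists (c *: s), (c *: n).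
    split; [exact: (SOS_Z Ssub)|exact: NZ|].
    by rewrite rZ starZ geC0_conj // -!scalerDr E.
have half0 : 0 <= (2^-1 : C) by rewrite invr_ge0.
have KN1 : ~ K (- 1).
  move=> [s [_ [Hs [c [j [j' [Hc Hj Hj' ->]]]]]]]; rewrite rN r1 starN star1 => E.
  (* [E] writes [-2] as [s + c + j + star j']; halving gives [-1]. *)
  apply: HN1; pose h : C := 2^-1.
  exists (h *: (s + c) + h *: j); last first.
    exists (star (h *: j')).
      by exists (h *: j') => //; exact: JZ.
    rewrite starZ (geC0_conj half0) -!scalerDr -/h -[s + c + j]addrA -addrA addrA.
    rewrite -[RHS]scale1r -(_ : h * 2 = 1); last by rewrite mulVf // pnatr_eq0.
    rewrite -scalerA; congr (_ *: _); rewrite -!addrA in E *; rewrite -E.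
    by rewrite scaler_nat mulr2n.
  exists (h *: (s + c)); last by exists (h *: j) => //; exact: JZ.
  split.
    apply: (subalgebraZ _ Ssub); apply: (subalgebraD Ssub).
      exact: (SOS_sub Ssub side_alg_star).
    exact: (commutator_sums_sub Ssub).
  exists (h *: s); first exact: (SOS_Z Ssub).
  rewrite -scalerBr [s + c]addrC addrK.
  exact: (commutator_sumsZ Ssub).
have Kunit u : exists t : R, K (t%:C%C *: 1 - u).
  have [M M0 HM] := bounded_order_unit Ssub (rS u) (S_bounded (rS u)).
  have [m Mm] := complex_realP M (ger0_real M0); subst M.
  exists (m / 2), (m%:C%C%:A - (r u + star (r u))), 0; split=> //.
  rewrite addr0 rD rN rZ r1 starD starN starZ star1.
  rewrite addrACA -opprD; congr (_ - _); rewrite -scalerDl; congr (_ *: _).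
  rewrite geC0_conj; last by rewrite ler0c divr_ge0 // -ler0c.
  by rewrite -rmorphD /=; congr (_%:C)%C; field.
have [t [tD tZ tK t1]] := cone_separation Kcone KN1 Kunit.
have t0 : t 0 = 0 by have := tZ 0 0; rewrite rmorph0 scale0r mul0r.
have tN u : t (- u) = - t u by apply/eqP; rewrite -addr_eq0 -tD addNr t0.
(* Both [u] and [- u] lie in [K]. *)
have t_null u : N (r u + star (r u)) -> t u = 0.
  have half v : N (r v + star (r v)) -> 0 <= t v.
    move=> Nv; apply: tK; exists 0, (r v + star (r v)).
    by split=> //; [exact: SOS0|rewrite add0r].
  move=> Nu; apply/eqP; rewrite eq_le half // andbT -oppr_ge0 -tN half //.
  by rewrite rN starN -opprD -scaleN1r; exact: NZ.
have t_anti u : star u = - u -> t u = 0.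
  by move=> su; apply: t_null; rewrite -r_star su rN subrr.
pose i : C := 'i%C.
have ii : i * i = -1 by rewrite /i -expr2 sqr_i.
have ic : i^* = - i.
  by rewrite -[LHS]/(conjc i); apply/eqP; rewrite eq_complex /= oppr0 !eqxx.
(* The complex-linear functional with real part [t]. *)
pose tau u : C := (t u)%:C%C - i * (t (i *: u))%:C%C.
have tauD u v : tau (u + v) = tau u + tau v.
  by rewrite /tau scalerDr !tD !rmorphD /=; ring.
have tauR (x : R) u : tau (x%:C%C *: u) = x%:C%C * tau u.
  by rewrite /tau scalerA [i * x%:C%C]mulrC -scalerA !tZ !rmorphM /=; ring.
have taui u : tau (i *: u) = i * tau u.
  rewrite /tau scalerA ii scaleN1r tN rmorphN /= [RHS]mulrBr [i * (i * _)]mulrA ii; ring.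
have tauZ c u : tau (c *: u) = c * tau u.
  rewrite [c]complexE -/i scalerDl tauD tauR -scalerA taui tauR; ring.
have tau_null u : N (r u) -> tau u = 0.
  move=> Nu; have tn v : N (r v) -> t v = 0.
    by move=> Nv; apply: t_null; apply: ND => //; exact: N_star.
  by rewrite /tau !tn ?rmorph0 ?mulr0 ?subr0 // rZ; exact: NZ.
exists tau; split.
- by move=> c u v; rewrite tauD tauZ.
- move=> u; have st v : t (star v) = t v.
    apply/eqP; rewrite -subr_eq0 -tN -tD; apply/eqP/t_anti.
    by rewrite starD starN starK opprB.
  have -> : tau (star u) = (t u)%:C%C + i * (t (i *: u))%:C%C.
    rewrite /tau; have -> : i *: star u = star (- i *: u).
      by rewrite starZ rmorphN /= ic opprK.
    by rewrite !st scaleNr tN rmorphN mulrN opprK.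
  have cR (x : R) : (x%:C%C)^* = x%:C%C :> C by exact: conjc_real.
  by rewrite /tau rmorphB rmorphM /= !cR ic mulNr opprK.
(* [i] times a self-adjoint element is anti-Hermitian, so the imaginary part vanishes. *)
- move=> u; have -> : tau (star u * u) = (t (star u * u))%:C%C.
    rewrite /tau [t (i *: _)]t_anti ?rmorph0 ?mulr0 ?subr0 //.
    by rewrite starZ starM starK ic scaleNr.
  rewrite ler0c; apply: tK; exists (2 *: (star (r u) * r u)), 0; split=> //.
    by apply: (SOS_Z Ssub) => //; exact: SOS_square.
  by rewrite rM r_star starM starK addr0 scaler_nat mulr2n.
- rewrite /tau t1 [t (i *: _)]t_anti ?rmorph0 ?mulr0 ?subr0 ?rmorph1 //.
  by rewrite starZ star1 ic scaleNr.
- split=> [u v|u Ju]; last by apply: tau_null; rewrite rid; [exact: N_ideal|exact: JS].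
  apply/eqP; rewrite -subr_eq0 -[X in _ - X]mul1r -mulNr -tauZ scaleN1r -tauD.
  apply/eqP/tau_null; rewrite rD rN !rM; apply: N_comm.
  exact: commutator_sums1.
Qed.

Lemma perfect_vector_complete :
  ~ set_add (set_add (SOS_tilde S) J) (star_set J) (-1) ->
  exists (H : hilbert R) (pi : star_rep U H) (psi : H), perfect_vector pi psi.
Proof.
move=> /tracial_state[tau [tau_lin tau_star tau_ge0 tau1 [tauC tauJ]]].
have k_lin c u v w : tau (star w * (c *: u + v)) =
    c * tau (star w * u) + tau (star w * v).
  by rewrite mulrDr -scalerAr tau_lin.
have k_herm u v : tau (star v * u) = (tau (star u * v))^*.
  by rewrite -tau_star starM starK.
pose k : psd_form U := @PsdForm C U (fun u v => tau (star v * u)) k_lin k_herm tau_ge0.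
have [||||||| L [L_lin L1 LM Lp Lq]] := @U_univ U
  (fun x a => (lmul (p x a) : {linear U -> U}))
  (fun y b => (rmul (f y b) : {linear U -> U})).
- by move=> x a y b v /=; rewrite /lmul /rmul mulrA.
- by move=> x a v /=; rewrite /lmul mulrA pp.
- move=> y b v /=; rewrite /rmul -mulrA.
  by case: (mirror_sum_pvm y) => _ -> _ _.
- move=> x a a' v aa' /=; rewrite /lmul mulrA.
  by case: (p_pvm x) => _ _ -> //; rewrite mul0r.
- move=> y b b' v bb' /=; rewrite /rmul -mulrA.
  by case: (mirror_sum_pvm y) => _ _ -> //; rewrite ?mulr0 // eq_sym.
- by move=> x v /=; rewrite /lmul -mulr_suml psum mul1r.
- move=> y v /=; rewrite /rmul -mulr_sumr.
  by case: (mirror_sum_pvm y) => _ _ _ ->; rewrite mulr1.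
have L_adj u v w : k (L u v) w = k v (L (star u) w).
  move: u v w; apply: (U_ind (T := fun u => forall v w, k (L u v) w = k v (L (star u) w))).
  - split=> [v w|c u u' Hu Hu' v w|u u' Hu Hu' v w].
    + by rewrite star1 !L1.
    + by rewrite starD starZ !L_lin pform_linear Hu Hu' pformDr pformZr conjCK.
    + by rewrite starM !LM Hu Hu'.
  - by move=> x a v w; rewrite pstar !Lp /= /lmul starM pstar mulrA.
  (* Traciality moves [f y b] from the right end of the product to the left end, where it belongs to
     the adjoint of [w * f y b]. *)
  - move=> y b v w; rewrite qstar !Lq /= /rmul starM mirror_sum_star.
    by rewrite mulrA tauC mulrA.
(* A self-adjoint idempotent satisfies this identity, and Cauchy-Schwarz then bounds its norm by
   1. *)
have contract T : (forall v, k (T v) (T v) = k (T v) v) ->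
    exists2 M, 0 <= M & forall v, pnorm k (T v) <= M * pnorm k v.
  move=> HT; exists 1 => // v; rewrite mul1r.
  have := pform_le k (T v) v; rewrite -HT -pnorm_sqr ger0_norm ?exprn_ge0 ?pnorm_ge0 //.
  have := pnorm_ge0 k (T v); rewrite le0r expr2 => /orP[/eqP->|Tv0].
    by rewrite pnorm_ge0.
  by rewrite ler_pM2l.
have L_bounded u : exists2 M, 0 <= M & forall v, pnorm k (L u v) <= M * pnorm k v.
  move: u; apply: (U_ind (T := fun u =>
      exists2 M, 0 <= M & forall v, pnorm k (L u v) <= M * pnorm k v)).
  - split=> [|c u v [M M0 Hu] [M' M'0 Hv]|u v [M M0 Hu] [M' M'0 Hv]].
    + by exists 1 => // v; rewrite L1 mul1r.
    + exists (`|c| * M + M') => [|w]; first by rewrite addr_ge0 ?mulr_ge0.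
      rewrite L_lin (le_trans (pnormD _ _ _)) // pnormZ mulrDl -mulrA lerD //.
      by rewrite ler_wpM2l.
    + exists (M * M') => [|w]; first exact: mulr_ge0.
      by rewrite LM (le_trans (Hu _)) // -mulrA ler_wpM2l.
  - move=> x a; apply: contract => v.
    by rewrite !L_adj pstar -LM pp.
  - move=> y b; apply: contract => v.
    by rewrite !L_adj qstar -LM qq.
exists (hilbert_completion k), (ext_rep L_lin L1 LM L_adj L_bounded).
exists (cembed k 1); split.
  rewrite cnormE cnorm_cembed /pnorm /= star1 mulr1 tau1.
  exact: sqrtC1.
move=> x y a b lb; rewrite ext_rep_embed LM Lp Lq /= /lmul /rmul mul1r.
apply: cnorm_eq0; rewrite cnorm_cembed /pnorm /= tauJ ?sqrtC0 //.
(* The squared norm of the class of [p x a * f y b] is [tau] of an element of [J]. *)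
have Jpf : J (p x a * f y b) by apply: gen_ideal_gen; exists x, y, a, b.
case: mirror_idealP => _ _ _ JMl _; apply: JMl => //.
by apply: side_alg_star; exact: JS.
Qed.

End Sufficiency.

Lemma SOS_sub_SOS_tilde :
  set_add (set_add (SOS S) J) (star_set J) (-1) ->
  set_add (set_add (SOS_tilde S) J) (star_set J) (-1).
Proof.
move=> [w [s Hs [j Hj <-]] [j' Hj' E]]; exists (s + j); last by exists j'.
by exists s; [exact: (SOS_SOS_tilde Ssub side_alg_star)|exists j].
Qed.

End HalfGame.

(** * Perfect strategies *)

Section WinningProbability.
Variables (R : realType) (U : starAlgType R[i]) (X Y A B : finType).
Local Notation C := R[i].
Variables (lam : X -> Y -> A -> B -> bool) (p : X -> A -> U) (q : Y -> B -> U).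
Hypothesis p_pvm : forall x, pvm (p x).
Hypothesis q_pvm : forall y, pvm (q y).
Hypothesis pqC : forall x a y b, p x a * q y b = q y b * p x a.
Hypothesis XY_gt0 : (0 < #|X| * #|Y|)%N.
Variables (H : hilbert R) (pi : star_rep U H) (psi : H).
Hypothesis psi1 : `|psi| = 1.
Let pstar x a : star (p x a) = p x a. Proof. by case: (p_pvm x). Qed.
Let qstar y b : star (q y b) = q y b. Proof. by case: (q_pvm y). Qed.
Let pp x a : p x a * p x a = p x a. Proof. by case: (p_pvm x). Qed.
Let qq y b : q y b * q y b = q y b. Proof. by case: (q_pvm y). Qed.
Let psum x : \sum_a p x a = 1. Proof. by case: (p_pvm x). Qed.
Let qsum y : \sum_b q y b = 1. Proof. by case: (q_pvm y). Qed.

Definition win_operator : U := (#|X| * #|Y|)%N%:R^-1 *: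
  \sum_x \sum_y \sum_a \sum_b (lam x y a b)%:R *: (p x a * q y b).

Let phi u : C := inner H (pi u psi) psi.

Let rep0 w : pi 0 w = 0.
Proof. by have := rep_linear pi (-1) 0 0 w; rewrite scaler0 addr0 scaleN1r addNr. Qed.
Let phi0 : phi 0 = 0. Proof. by rewrite /phi rep0 linear0l. Qed.
Let phi_lin c u v : phi (c *: u + v) = c * phi u + phi v.
Proof. by rewrite /phi rep_linear linearPl. Qed.
Let phiD u v : phi (u + v) = phi u + phi v.
Proof. by have := phi_lin 1 u v; rewrite scale1r mul1r. Qed.
Let phiZ c u : phi (c *: u) = c * phi u.
Proof. by have := phi_lin c u 0; rewrite phi0 !addr0. Qed.
Let phi_sum (K : finType) (F : K -> U) : phi (\sum_i F i) = \sum_i phi (F i).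
Proof. exact: (big_morph _ phiD phi0). Qed.

Let weight x y a b : C := phi (p x a * q y b).

(** A product of commuting projections is a projection. *)
Let weightE x y a b : weight x y a b = `|pi (p x a * q y b) psi| ^+ 2.
Proof.
have e_proj : p x a * q y b = star (p x a * q y b) * (p x a * q y b).
  rewrite starM pstar qstar -pqC mulrA -(mulrA (p x a)).
  by rewrite -pqC mulrA pp -mulrA qq.
by rewrite inner_norm /weight /phi {1}e_proj repM rep_star starK.
Qed.

Let weight_ge0 x y a b : 0 <= weight x y a b.
Proof. by rewrite weightE exprn_ge0. Qed.

Let weight_sum : \sum_x \sum_y \sum_a \sum_b weight x y a b = (#|X| * #|Y|)%N%:R.
Proof.
have sum1 x y : \sum_a \sum_b weight x y a b = 1.
  transitivity (phi (\sum_a \sum_b p x a * q y b)).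
    by rewrite phi_sum; apply: eq_bigr => a _; rewrite phi_sum.
  under eq_bigr do rewrite -mulr_sumr qsum mulr1.
  by rewrite psum /phi rep1 -inner_norm psi1 expr1n.
under eq_bigr do under eq_bigr do rewrite sum1.
under eq_bigr do rewrite sumr_const.
by rewrite sumr_const -mulrnA mulnC.
Qed.

Let phi_Phi : phi win_operator = (#|X| * #|Y|)%N%:R^-1 *
  \sum_x \sum_y \sum_a \sum_b (lam x y a b)%:R * weight x y a b.
Proof.
rewrite /win_operator phiZ phi_sum; congr (_ * _); apply: eq_bigr => x _.
rewrite phi_sum; apply: eq_bigr => y _; rewrite phi_sum; apply: eq_bigr => a _.
by rewrite phi_sum; apply: eq_bigr => b _; rewrite phiZ.
Qed.

(** The weights are nonnegative with total [|X||Y|], so winning with certainty means that the losing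
    weights sum to 0, hence vanish one by one. *)
Lemma perfect_expectation :
  phi win_operator = 1 <->
  forall x y a b, ~~ lam x y a b -> pi (p x a * q y b) psi = 0.
Proof.
have card_neq0 : (#|X| * #|Y|)%N%:R != 0 :> C.
  by rewrite pnatr_eq0 -lt0n.
rewrite phi_Phi; split=> [E x y a b lb|E].
  pose loss x y a b := (~~ lam x y a b)%:R * weight x y a b.
  have loss_ge0 x' y' a' b' : 0 <= loss x' y' a' b' by rewrite mulr_ge0.
  have : \sum_x \sum_y \sum_a \sum_b loss x y a b = 0.
    have : \sum_x \sum_y \sum_a \sum_b (lam x y a b)%:R * weight x y a b =
        \sum_x \sum_y \sum_a \sum_b weight x y a b.
      by rewrite weight_sum; apply: (mulfI (invr_neq0 card_neq0)); rewrite E mulVf.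
    move=> won; apply: (addIr (\sum_x \sum_y \sum_a \sum_b weight x y a b)).
    rewrite add0r -{1}won -big_split; apply: eq_bigr => x' _.
    rewrite -big_split; apply: eq_bigr => y' _; rewrite -big_split.
    apply: eq_bigr => a' _; rewrite -big_split; apply: eq_bigr => b' _.
    by rewrite /= /loss; case: lam; rewrite ?mul1r ?mul0r ?add0r ?addr0.
  move/psumr_eq0P => /(_ _ x isT) H1.
  have : \sum_y \sum_a \sum_b loss x y a b = 0.
    by apply: H1 => x' _; do 3!(apply: sumr_ge0 => ? _).
  move/psumr_eq0P => /(_ _ y isT) H2.
  have : \sum_a \sum_b loss x y a b = 0.
    by apply: H2 => y' _; do 2!(apply: sumr_ge0 => ? _).
  move/psumr_eq0P => /(_ _ a isT) H3.
  have : \sum_b loss x y a b = 0.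
    by apply: H3 => a' _; apply: sumr_ge0 => ? _.
  move/psumr_eq0P => /(_ _ b isT) H4.
  have : loss x y a b = 0 by apply: H4.
  rewrite /loss lb mul1r weightE => /eqP; rewrite expf_eq0 /= normr_eq0.
  by move/eqP.
have -> : \sum_x \sum_y \sum_a \sum_b (lam x y a b)%:R * weight x y a b =
    \sum_x \sum_y \sum_a \sum_b weight x y a b.
  apply: eq_bigr => x _; apply: eq_bigr => y _; apply: eq_bigr => a _.
  apply: eq_bigr => b _; case: (boolP (lam x y a b)) => [_|/E E0].
    by rewrite mul1r.
  by rewrite weightE E0 normr0 expr0n mulr0.
by rewrite weight_sum mulVf.
Qed.

End WinningProbability.

Section PerfectStrategies.
Variables (R : realType) (G : game).
Local Notation C := R[i].
Local Notation U := (game_alg R G).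
Local Notation p := (@e1 R G).
Local Notation q := (@e2 R G).

Lemma e1_pvm x : pvm (p x).
Proof.
by split; [exact: star_e1|exact: e1_idem|exact: e1_orth|exact: e1_sum].
Qed.

Lemma e2_pvm y : pvm (q y).
Proof.
by split; [exact: star_e2|exact: e2_idem|exact: e2_orth|exact: e2_sum].
Qed.


Lemma has_perfect_strategyP :
  has_perfect_strategy R G <->
  exists (H : hilbert R) (pi : star_rep U H) (psi : H),
    perfect_vector (@score G) p q pi psi.
Proof.
have XY_gt0 : (0 < #|qX G| * #|qY G|)%N by rewrite muln_gt0 qX_gt0 qY_gt0.
have winP H pi psi psi1 :=
  @perfect_expectation R U _ _ _ _ (@score G) p q e1_pvm e2_pvm (@e1_e2C R G) XY_gt0 H pi psi psi1.
split=> -[H [pi [psi [psi1 E]]]]; exists H, pi, psi.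
  by split; [exact: psi1|exact: (iffLR (winP H pi psi psi1) E)].
by split; [exact: psi1|exact: (iffRL (winP H pi psi psi1) E)].
Qed.

Lemma perfect_vector_swap (H : hilbert R) (pi : star_rep U H) (psi : H) :
  perfect_vector (@score G) p q pi psi <->
  perfect_vector (fun y x b a => score x y a b) q p pi psi.
Proof.
split=> -[psi1 E]; split=> // x y a b lb.
  by rewrite -e1_e2C E.
by rewrite e1_e2C E.
Qed.

Lemma game_universal : universal_pvm_pair p q.
Proof. by move=> V P Q; exact: game_alg_action. Qed.

Lemma game_universal_swap : universal_pvm_pair q p.
Proof.
move=> V Q P QP QQ PP QO PO QS PS.
have [|||||||L [? ? ? ? ?]] := @game_alg_action R G V P Q => //.
by exists L.
Qed.

Lemma U1E : @U1 R G = side_alg p.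
Proof. by []. Qed.

Lemma U2E : @U2 R G = side_alg q.
Proof. by []. Qed.

Lemma J_mir1E (eta : qY G -> qX G) : J_mir1 (R := R) eta = mirror_ideal (@score G) p eta.
Proof. by rewrite /J_mir1 /mirror_ideal U1E. Qed.

Lemma J_mir2E (xi : qX G -> qY G) :
  J_mir2 (R := R) xi = mirror_ideal (fun y x b a => score x y a b) q xi.
Proof.
rewrite /J_mir2 /mirror_ideal U2E; congr (gen_ideal _ _).
by apply/seteqP; split=> u /= [x [y [a [b ?]]]]; exists y, x, b, a.
Qed.

End PerfectStrategies.

Theorem corollary3p2 (R : realType) (G : game)
    (xi : qX G -> qY G) (eta : qY G -> qX G) :
  mirror_game xi eta -> regular xi eta ->
  ((has_perfect_strategy R G <->
      ~ set_add (set_add (SOS_tilde (@U1 R G)) (J_mir1 eta))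
                (star_set (J_mir1 eta)) (-1)) /\
   (set_add (set_add (SOS (@U1 R G)) (J_mir1 eta))
            (star_set (J_mir1 eta)) (-1) ->
      ~ has_perfect_strategy R G)) /\
  ((has_perfect_strategy R G <->
      ~ set_add (set_add (SOS_tilde (@U2 R G)) (J_mir2 xi))
                (star_set (J_mir2 xi)) (-1)) /\
   (set_add (set_add (SOS (@U2 R G)) (J_mir2 xi))
            (star_set (J_mir2 xi)) (-1) ->
      ~ has_perfect_strategy R G)).
Proof.
move=> [mir1 mir2] [reg1 reg2].
(* A fixed answer of each player defines the retraction onto the other player's algebra. *)
have /card_gt0P[a0 _] := aA_gt0 G.
have /card_gt0P[b0 _] := aB_gt0 G.
have pqC := @e1_e2C R G.
have qpC y b x a := esym (pqC x a y b).
have mir1' x b a a' : a != a' -> ~~ (score x (xi x) a b && score x (xi x) a' b).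
  exact: mir1.
have mir2' y b b' a : b != b' -> ~~ (score (eta y) y a b && score (eta y) y a b').
  exact: mir2.
have reg1' x b : exists a, score x (xi x) a b.
  have : b \in [set: aB G]%SET by rewrite finset.in_setT.
  by rewrite -(reg1 x) => /finset.bigcupP[a _]; rewrite finset.inE => ?; exists a.
have reg2' y a : exists b, score (eta y) y a b.
  have : a \in [set: aA G]%SET by rewrite finset.in_setT.
  by rewrite -(reg2 y) => /finset.bigcupP[b _]; rewrite finset.inE => ?; exists b.
have equiv1 : has_perfect_strategy R G <->
    ~ set_add (set_add (SOS_tilde (@U1 R G)) (J_mir1 eta))
                (star_set (J_mir1 eta)) (-1).
  rewrite U1E J_mir1E; split=> [/has_perfect_strategyP[H [pi [psi perf]]]|N1].
    exact: perfect_vector_sound (@e1_pvm R G) (@e2_pvm R G) pqC mir1 mir2 _ _ _ perf.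
  apply/has_perfect_strategyP.
  exact: perfect_vector_complete (@e1_pvm R G) (@e2_pvm R G) mir2 reg2'
    (@game_alg_ind R G) (@game_universal R G) b0 N1.
have equiv2 : has_perfect_strategy R G <->
    ~ set_add (set_add (SOS_tilde (@U2 R G)) (J_mir2 xi))
                (star_set (J_mir2 xi)) (-1).
  rewrite U2E J_mir2E; split=> [/has_perfect_strategyP[H [pi [psi /perfect_vector_swap perf]]]|N1].
    exact: perfect_vector_sound (@e2_pvm R G) (@e1_pvm R G) qpC mir2' mir1' _ _ _ perf.
  apply/has_perfect_strategyP.
  have ind2 (T : set (game_alg R G)) (Tsub : subalgebra T) T2 T1 :=
    @game_alg_ind R G T Tsub T1 T2.
  have [H [pi [psi perf]]] := perfect_vector_complete (@e2_pvm R G) (@e1_pvm R G)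
    mir1' reg1' ind2 (@game_universal_swap R G) a0 N1.
  by exists H, pi, psi; apply/perfect_vector_swap.
split; split=> //.
  move=> HS; rewrite equiv1; apply; rewrite U1E J_mir1E in HS *.
  exact: (SOS_sub_SOS_tilde (@e1_pvm R G) HS).
move=> HS; rewrite equiv2; apply; rewrite U2E J_mir2E in HS *.
exact: (SOS_sub_SOS_tilde (@e2_pvm R G) HS).
Qed.
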